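(* Suppose that $2<p<\infty$. Then there exist a function $f$ in $(B^1_{\infty,1})_+(\mathbb{T}^2)$ and unitary operators $U_1$, $U_2$ and $V$ on a Hilbert space such that $U_1-U_2\in\boldsymbol{S}_p$ but $f(U_1,V)-f(U_2,V)\notin\boldsymbol{S}_p$.
   Context: $\boldsymbol{S}_p$ is the Schatten--von Neumann class. The operators $U_j$ and $V$ need not commute. Besov class on the torus. Fix an infinitely differentiable function $w\ge 0$ on $\mathbb{R}$ with $\operatorname{supp}w\subset[\frac12,2]$ and $w(t)=1-w(t/2)$ for $t\in[1,2]$. For $j=(j_1,j_2)\in\mathbb{Z}^2$ put $|j|=(j_1^2+j_2^2)^{1/2}$. Let $W_n(\zeta)=\sum_{j\in\mathbb{Z}^2}w(|j|/2^n)\zeta^j$ for $n\ge1$ and $W_0(\zeta)=\sum_{|j|\le1}\zeta^j$, $\zeta\in\mathbb{T}^2$. For a distribution $f$ on $\mathbb{T}^2$ put $f_n=f*W_n$ (i.e. $\widehat f_n=\widehat W_n\widehat f$). Then $f\in B^1_{\infty,1}(\mathbb{T}^2)$ means $\|f\|_{B^1_{\infty,1}}:=\sum_{n\ge0}2^n\|f_n\|_{L^\infty}<\infty$. The subspace $(B^1_{\infty,1})_+(\mathbb{T}^2)$ consists of those $f\in B^1_{\infty,1}(\mathbb{T}^2)$ with $\widehat f(j_1,j_2)=0$ whenever $\min\{j_1,j_2\}<0$. Functions $f\in B^1_{\infty,1}(\mathbb{T}^2)$ have absolutely convergent Fourier series, and for unitary $U,V$ one defines $f(U,V)=\sum_{j,k\in\mathbb{Z}}\widehat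 f(j,k)U^jV^k$. *)

(* Defs.v *)
From HB Require Import structures.
From mathcomp Require Import all_boot all_order all_algebra finmap complex.
From mathcomp Require Import all_classical all_reals all_analysis.

Set Implicit Arguments.
Unset Strict Implicit.
Unset Printing Implicit Defensive.

Import Order.TTheory GRing.Theory Num.Theory.
Import numFieldNormedType.Exports.

Local Open Scope classical_set_scope.
Local Open Scope ring_scope.

Definition norm_of (R : realType) (H : lmodType R[i])
    (form : {dot H for Num.conj}) (x : H) : R :=
  Num.sqrt (complex.Re (form x x)).

Record hilbertType (R : realType) := HilbertType {
  hcarrier :> lmodType R[i];
  inner : {dot hcarrier for Num.conj};
  hcomplete : forall u : nat -> hcarrier,
    (forall e : R, 0 < e -> exists N : nat, forall m n : nat,
       (N <= m)%N -> (N <= n)%N -> norm_of inner (u m - u n) < e) ->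
    exists l : hcarrier, forall e : R, 0 < e -> exists N : nat, forall n : nat,
       (N <= n)%N -> norm_of inner (u n - l) < e
}.

Definition hnorm (R : realType) (H : hilbertType R) (x : H) : R :=
  norm_of (inner H) x.

(* [+oo] when [T] is unbounded *)
Definition opnorm (R : realType) (H : hilbertType R) (T : H -> H) : \bar R :=
  ereal_sup [set (hnorm (T x))%:E | x in [set x : H | hnorm x <= 1]].

(* The range of [K] lies in the span of [n] vectors. *)
Definition rank_le (R : realType) (H : hilbertType R) (n : nat)
    (K : {linear H -> H}) : Prop :=
  exists b : 'I_n -> H, forall x : H,
    exists c : 'I_n -> R[i], K x = \sum_(k < n) c k *: b k.

Definition singular_value (R : realType) (H : hilbertType R)
    (T : {linear H -> H}) (n : nat) : \bar R :=
  ereal_inf [set opnorm (T \- K) | K in [set K : {linear H -> H} | rank_le n K]].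

Definition schatten (R : realType) (H : hilbertType R) (p : R)
    (T : {linear H -> H}) : Prop :=
  (opnorm T < +oo)%E /\
  (\sum_(0 <= n <oo) (singular_value T n `^ p) < +oo)%E.

Record unitary (R : realType) (H : hilbertType R) := Unitary {
  uop :> {linear H -> H};
  uadj : {linear H -> H};
  uadjP : forall x y : H, inner H (uop x) y = inner H x (uadj y);
  uadjK : forall x : H, uadj (uop x) = x;
  uopK : forall x : H, uop (uadj x) = x
}.

(* Integer powers; the inverse of a unitary operator is its adjoint. *)
Definition upow (R : realType) (H : hilbertType R) (U : unitary H) (j : int)
    (x : H) : H :=
  match j with
  | Posz n => iter n U x
  | Negz n => iter n.+1 (uadj U) x
  end.

Definition circle (R : realType) := {z : R[i] | `|z| == 1}.

Lemma expi_subproof (R : realType) (t : R) :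
  `|(cos t +i* sin t)%C : R[i]| == 1.
Proof. by rewrite normc_def /= cos2Dsin2 sqrtr1. Qed.

Definition expi (R : realType) (t : R) : circle R :=
  exist _ (cos t +i* sin t)%C (expi_subproof t).

Definition torus_fun (R : realType) := circle R -> circle R -> R[i].

(* Normalized Lebesgue measure on the torus is handled through the
   parametrization (s, t) |-> (e^{is}, e^{it}) of the square [0, 2pi]^2. *)
Definition square (R : realType) : set (measurableTypeR R * measurableTypeR R) :=
  [set x | 0 <= x.1 <= 2 * pi /\ 0 <= x.2 <= 2 * pi].

Definition leb2 (R : realType) :
    {measure set (measurableTypeR R * measurableTypeR R) -> \bar R} :=
  (@lebesgue_measure R \x @lebesgue_measure R)%E.

Definition torus_integrable (R : realType) (f : torus_fun R) : Prop :=
  (@leb2 R).-integrable (@square R)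
    (fun x => (complex.Re (f (expi x.1) (expi x.2)))%:E) /\
  (@leb2 R).-integrable (@square R)
    (fun x => (complex.Im (f (expi x.1) (expi x.2)))%:E).

Definition torus_mean (R : realType) (f : torus_fun R) : R[i] :=
  (((2 * pi) ^- 2 *
     Rintegral (@leb2 R) (@square R)
       (fun x => complex.Re (f (expi x.1) (expi x.2))))
   +i*
   ((2 * pi) ^- 2 *
     Rintegral (@leb2 R) (@square R)
       (fun x => complex.Im (f (expi x.1) (expi x.2)))))%C.

Definition fourier (R : realType) (f : torus_fun R) (j : int * int) : R[i] :=
  torus_mean (fun z1 z2 => f z1 z2 * (val z1 ^ (- j.1) * val z2 ^ (- j.2))).

Definition besov_cutoff (R : realType) (w : R -> R) : Prop :=
  [/\ forall (n : nat) (t : R), derivable (derive1n n w) t 1,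
      forall t : R, 0 <= w t,
      closure [set t | w t != 0] `<=` [set t | 2^-1 <= t <= 2] &
      forall t : R, 1 <= t <= 2 -> w t = 1 - w (t / 2)].

Definition lattice_norm (R : realType) (j : int * int) : R :=
  Num.sqrt (j.1%:~R ^+ 2 + j.2%:~R ^+ 2).

(* Fourier coefficients of W_n *)
Definition What (R : realType) (w : R -> R) (n : nat) (j : int * int) : R :=
  match n with
  | 0 => if lattice_norm R j <= 1 then 1 else 0
  | n'.+1 => w (lattice_norm R j / 2 ^+ n)
  end.

(* f * W_n; only finitely many terms of the sum are nonzero, because the
   support of [w] is bounded. *)
Definition besov_piece (R : realType) (w : R -> R) (f : torus_fun R) (n : nat)
    : torus_fun R := fun z1 z2 =>
  \sum_(j \in [set: int * int])
    (What w n j)%:C%C * fourier f j * (val z1 ^ j.1 * val z2 ^ j.2).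

(* The L^oo norm; it is only used for the trigonometric polynomials f * W_n,
   whose essential supremum is a supremum, by continuity. *)
Definition torus_sup (R : realType) (g : torus_fun R) : \bar R :=
  ereal_sup [set (complex.Re `|g z.1 z.2|)%:E | z in [set: circle R * circle R]].

Definition besov_norm (R : realType) (w : R -> R) (f : torus_fun R) : \bar R :=
  (\sum_(0 <= n <oo) ((2 ^+ n)%:E * torus_sup (besov_piece w f n)))%E.

(* Every distribution whose Besov norm is finite has an absolutely convergent
   Fourier series, so it is given by an integrable function. *)
Definition besov (R : realType) (w : R -> R) (f : torus_fun R) : Prop :=
  torus_integrable f /\ (besov_norm w f < +oo)%E.

Definition besov_plus (R : realType) (w : R -> R) (f : torus_fun R) : Prop :=
  besov w f /\
  forall j : int * int, Order.min j.1 j.2 < 0 -> fourier f j = 0.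

Definition fun_partial (R : realType) (H : hilbertType R) (f : torus_fun R)
    (U V : unitary H) (F : {fset int * int}) (x : H) : H :=
  \sum_(j <- F) fourier f j *: upow U j.1 (upow V j.2 x).

(* A = f(U, V): the double series converges to A unconditionally (along the
   finite subsets of Z^2) in operator norm. *)
Definition is_fun_unitary (R : realType) (H : hilbertType R) (f : torus_fun R)
    (U V : unitary H) (A : {linear H -> H}) : Prop :=
  forall e : R, 0 < e -> exists F0 : {fset int * int},
    forall F : {fset int * int}, (F0 `<=` F)%fset ->
      (opnorm (A \- fun_partial f U V F)%R <= e%:E)%E.

(* Main.v *)
Require Import Defs.
From HB Require Import structures.
From mathcomp Require Import all_boot all_order all_algebra finmap complex.
From mathcomp Require Import all_classical all_reals all_analysis.
From mathcomp Require Import measurable_realfun ring lra zify.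

Set Implicit Arguments.
Unset Strict Implicit.
Unset Printing Implicit Defensive.

Import Order.TTheory GRing.Theory Num.Theory.
Import numFieldNormedType.Exports.
Import ComplexField Normc.
Local Open Scope ring_scope.

(* Let [V] be the cyclic shift of a cycle of length [2 N] and [U = D V D], where
   the diagonal matrix [D] carries the Rudin-Shapiro signs [eps_k].  Then
   [U^(N-k) V^k e_0 = eps_k e_N], so that the homogeneous polynomial
   [P = sum_(k < N) eps_k z1^(N-k) z2^k], which is bounded by a multiple of
   [sqrt N] on the torus, satisfies [P(U, V) e_0 = N e_N].  Multiplying [P] by
   [z1^L] with [L] much larger than [N] concentrates its spectrum near the
   frequency [L], so that its Besov norm is comparable to [L sqrt N], while
   rotating [U] by [e^(i pi / L)] essentially changes the sign of
   [U^L P(U, V)]: a perturbation of size [1 / L] of [U] moves the operator by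
   at least [N / (L sqrt N) = sqrt N / L] relatively to the Besov norm.
   In the direct sum over [n] of about [L^p / N] copies of such blocks, up to
   factors [2^n], with [L] and [N] growing fast with [n], the perturbation is
   in [S_p], whereas the [p]-th powers of these displacements have sum of order
   [N^(p/2 - 1)] on each block, which is unbounded precisely because [p > 2]. *)

(** * Complex numbers and series *)

(** One function must serve all blocks, so on the cycle of scale [n] the homogeneous parts of [f]
    belonging to other scales act as well and could spoil the displacement. Only degrees matter
    here: a monomial of total degree [D] in the two shifts moves every basis vector by [D] steps, up
    to a scalar. Parts of lower scale have degree less than [width n] and stop short of the target
    position; parts of higher scale have degree divisible by the cycle length, since all sizes are
    powers of 2, and return to the start. At the target coordinate the interference is therefore
    exactly zero, and the difference of the two operators contains an exact multiple of an identity
    matrix, whose size is the number of copies; this bounds singular values from below. With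
    [b = bexp n] the sizes are [N = 2^(2 b)] and [L = 2^(8 b) = N^4]. Freezing the cutoff on a block
    costs [N^2 / (L sqrt N)], which this choice makes small. The weights [2^-n], present for
    summability, cost a power [2^(n (p + 1))] in the lower bound, against the gain
    [N^(p/2 - 1) = 2^(b (p - 2))]; the factor [K] in [b] lets the gain win. *)

Section Complex.
Context {R : realType}.
Implicit Types z w : R[i].

Lemma normc_sqr z : normc z ^+ 2 = complex.Re z ^+ 2 + complex.Im z ^+ 2.
Proof. by case: z => a b /=; rewrite sqr_sqrtr// addr_ge0 ?sqr_ge0. Qed.

Lemma ler_Re_normc z : `|complex.Re z| <= normc z.
Proof.
case: z => a b /=; rewrite -(@ler_pXn2r _ 2) ?nnegrE ?sqrtr_ge0//.
by rewrite sqr_sqrtr ?addr_ge0 ?sqr_ge0// real_normK ?num_real// lerDl sqr_ge0.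
Qed.

Lemma ler_Im_normc z : `|complex.Im z| <= normc z.
Proof.
case: z => a b /=; rewrite -(@ler_pXn2r _ 2) ?nnegrE ?sqrtr_ge0//.
by rewrite sqr_sqrtr ?addr_ge0 ?sqr_ge0// real_normK ?num_real// lerDr sqr_ge0.
Qed.

Lemma normc_conj z : normc (z^*)%C = normc z.
Proof. by case: z => a b /=; rewrite sqrrN. Qed.

Lemma normc_R (a : R) : normc (a%:C)%C = `|a|.
Proof. by rewrite /= expr0n addr0 sqrtr_sqr. Qed.

Lemma normc_ge0 z : 0 <= normc z.
Proof. by case: z => u v; exact: sqrtr_ge0. Qed.

(** Dot products are sesquilinear for the abstract [Num.conj]. Both conjugates multiply a nonzero
    [z] to its squared modulus, hence they agree. *)
Lemma conjCE (z : R[i]) : Num.conj z = (complex.Re z -i* complex.Im z)%C.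
Proof.
case: z => u v /=; rewrite -[RHS]/((u +i* v)^*)%C.
have [->|z0] := eqVneq (u +i* v)%C 0; first by rewrite rmorph0 conjc0.
by apply: (mulfI z0); rewrite -normCK sqr_normc.
Qed.

Lemma mul_conjc_unit z : normc z = 1 -> z * (z^*)%C = 1.
Proof.
case: z => c d h; have := normc_sqr (c +i* d)%C; rewrite h expr1n /= => e.
by apply/eqP; rewrite eq_complex /= e; apply/andP; split; apply/eqP; ring.
Qed.

Lemma Re_sum (I : Type) (r : seq I) (F : I -> R[i]) :
  complex.Re (\sum_(i <- r) F i) = \sum_(i <- r) complex.Re (F i).
Proof.
elim: r => [|i r IH]; first by rewrite !big_nil.
by rewrite !big_cons -IH; case: (F i) (\sum_(j <- r) F j) => [a b] [c d].
Qed.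

Lemma Im_sum (I : Type) (r : seq I) (F : I -> R[i]) :
  complex.Im (\sum_(i <- r) F i) = \sum_(i <- r) complex.Im (F i).
Proof.
elim: r => [|i r IH]; first by rewrite !big_nil.
by rewrite !big_cons -IH; case: (F i) (\sum_(j <- r) F j) => [a b] [c d].
Qed.

Lemma normc_sum_le (I : Type) (r : seq I) (F : I -> R[i]) :
  normc (\sum_(i <- r) F i) <= \sum_(i <- r) normc (F i).
Proof.
elim/big_ind2 : _ => [|x a y b hx hy|//]; first by rewrite normc0.
by rewrite (le_trans (le_normcD _ _))// lerD.
Qed.

Lemma normc_parallelogram (x y : R[i]) :
  normc (x + y) ^+ 2 + normc (x - y) ^+ 2 = 2 * (normc x ^+ 2 + normc y ^+ 2).
Proof. by rewrite !normc_sqr; case: x y => [a b] [c d] /=; ring. Qed.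

End Complex.

Section Series.
Context {R : realType}.
Implicit Types u v w : nat -> R.

(** Three series are what the real or imaginary part of [a * x + z] with complex [a] requires: two
    from the product and one from the summand. Other uses fill the spare slots with coefficient
    0. *)
Lemma lim_series_lin (a b c : R) u v w s :
  cvgn (series u) -> cvgn (series v) -> cvgn (series w) ->
  (forall n, s n = a * u n + b * v n + c * w n) ->
  limn (series s) = a * limn (series u) + b * limn (series v) + c * limn (series w).
Proof.
move=> cu cv cw h.
have -> : s = a *: u + b *: v + c *: w by apply/funext => n; rewrite h.
have ca := is_cvg_seriesZ (k := a) cu.
have cb := is_cvg_seriesZ (k := b) cv.
have cc := is_cvg_seriesZ (k := c) cw.
rewrite (lim_seriesD (is_cvg_seriesD ca cb) cc) (lim_seriesD ca cb).
by rewrite !lim_seriesZ.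
Qed.

Lemma bounded_series_cvg u (B : R) : (forall n, 0 <= u n) ->
  (forall n, series u n <= B) -> cvgn (series u).
Proof.
move=> u0 uB; apply: nondecreasing_is_cvgn.
  by apply: nondecreasing_series => n _ _; exact: u0.
by exists B => _ [n _ <-].
Qed.

Lemma series_le_lim u n : (forall n, 0 <= u n) -> cvgn (series u) ->
  series u n <= limn (series u).
Proof.
move=> u0 cu; apply: nondecreasing_cvgn_le => //.
by apply: nondecreasing_series => k _ _; exact: u0.
Qed.

Lemma lim_le_series u (B : R) : cvgn (series u) -> (forall n, series u n <= B) ->
  limn (series u) <= B.
Proof. by move=> cu uB; apply: limr_le => //; apply: nearW. Qed.

Lemma abs_series_cvg u v : (forall n, `|u n| <= v n) -> cvgn (series v) ->
  cvgn (series u).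
Proof.
move=> uv cv; apply: normed_cvg; apply: (series_le_cvg _ _ _ cv) => n //=.
by rewrite (le_trans _ (uv n)).
Qed.

Lemma cauchy_seq_cvg u :
  (forall e : R, 0 < e -> exists N : nat, forall m n : nat,
    (N <= m)%N -> (N <= n)%N -> `|u m - u n| < e) -> cvgn u.
Proof.
move=> h; apply/cauchy_cvgP/cauchy_exP => e e0; have [N hN] := h e e0.
exists (u N), N => // n /= Nn; rewrite /ball /=; exact: hN.
Qed.

Lemma cvg_sqr_dist (v : nat -> R) a : cvgn v ->
  ((a - v j) ^+ 2 @[j --> \oo] --> (a - limn v) ^+ 2)%classic.
Proof.
move=> cv; have h : (a - v j @[j --> \oo] --> a - limn v)%classic.
  by apply: cvgB; [exact: cvg_cst|exact: cv].
rewrite expr2; have -> : (fun j => (a - v j) ^+ 2) = (fun j => (a - v j) * (a - v j)).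
  by apply/funext => j; rewrite expr2.
exact: cvgM.
Qed.

Lemma lim_series_single (u : nat -> R) n : (forall m, m != n -> u m = 0) ->
  limn (series u) = u n.
Proof.
move=> h; apply: cvg_lim => //; apply: cvg_near_cst; exists n.+1 => // m /= nm.
rewrite /series /= (bigD1_seq n) ?mem_index_iota ?iota_uniq//= big1 ?addr0//.
Qed.

Lemma sum_half n : \sum_(0 <= k < n) (2 ^- k : R) <= 2.
Proof.
suff -> : \sum_(0 <= k < n) (2 ^- k : R) = 2 - 2 * 2 ^- n.
  by rewrite gerBl mulr_ge0// invr_ge0 exprn_ge0.
elim: n => [|n IH]; first by rewrite big_nil expr0 invr1 mulr1 subrr.
rewrite big_nat_recr//= IH exprS invfM.
have : (2 : R) * 2^-1 = 1 by rewrite divff.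
by rewrite mulrA => ->; ring.
Qed.

Lemma expr2_le1 (n m : nat) : (n <= m)%N -> 2 ^- m <= 2 ^- n :> R.
Proof. by move=> nm; rewrite lef_pV2 ?posrE ?exprn_gt0// ler_eXn2l ?ltr1n. Qed.

Lemma sum_eq_le (x : R) a M : 0 <= x -> \sum_(0 <= m < M) x *+ (m == a) <= x.
Proof.
move=> x0; have [aM|Ma] := ltnP a M.
  rewrite (bigD1_seq a) ?mem_index_iota ?iota_uniq//= eqxx big1 ?addr0// => m.
  by move=> /negbTE->.
rewrite big_nat big1// => m /andP[_ mM].
by rewrite ltn_eqF// (leq_trans mM).
Qed.

Lemma ler_sum_subset (I : eqType) (s r : seq I) (G : I -> R) : (forall i, 0 <= G i) ->
  uniq s -> {subset s <= r} -> \sum_(i <- s) G i <= \sum_(i <- r) G i.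
Proof.
move=> G0; elim: s r => [|x s IH] r /=; first by rewrite big_nil sumr_ge0.
move=> /andP[xs us] sr; have xr : x \in r by rewrite sr ?mem_head.
rewrite (perm_big _ (perm_to_rem xr)) /= !big_cons lerD2l.
apply: IH => // y ys; apply: rem_mem; last by rewrite sr// in_cons ys orbT.
by apply: contraNneq xs => <-.
Qed.

End Series.

(** * Operators on Hilbert spaces *)

Section HilbertNorm.
Context {R : realType} {H : hilbertType R}.
Implicit Types (x y : H) (a : R[i]).

Lemma hnorm_ge0 x : 0 <= hnorm x.
Proof. exact: sqrtr_ge0. Qed.

Lemma innerxx x : inner H x x = ((hnorm x ^+ 2)%:C)%C.
Proof.
have := dnorm_ge0 (inner H) x; rewrite lecE /= => /andP[/eqP i0 r0].
rewrite /hnorm /norm_of sqr_sqrtr //.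
by case: (inner H x x) i0 r0 => r s /= -> _.
Qed.

Lemma sqr_hnorm x : hnorm x ^+ 2 = complex.Re (inner H x x).
Proof. by rewrite innerxx. Qed.

Lemma hnorm_eq0 x : hnorm x = 0 -> x = 0.
Proof.
move=> x0; apply/eqP; rewrite -(dnorm_eq0 (inner H)) innerxx x0 expr0n.
by [].
Qed.

Lemma hnorm0 : hnorm (0 : H) = 0.
Proof. by rewrite /hnorm /norm_of linear0r /= sqrtr0. Qed.

Lemma sqr_hnormD x y : hnorm (x + y) ^+ 2 =
  hnorm x ^+ 2 + hnorm y ^+ 2 + 2 * complex.Re (inner H x y).
Proof.
rewrite !sqr_hnorm dnormD conjCE; case: (inner H x y) (inner H x x) (inner H y y).
by move=> u v [u1 v1] [u2 v2] /=; ring.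
Qed.

Lemma hnormZ a x : hnorm (a *: x) = normc a * hnorm x.
Proof.
apply/eqP; rewrite -(@eqrXn2 _ 2) ?hnorm_ge0 ?mulr_ge0 ?hnorm_ge0//; last first.
  by case: a => u v /=; exact: sqrtr_ge0.
rewrite exprMn !sqr_hnorm dnormZ innerxx; case: a => u v /=.
by apply/eqP; ring.
Qed.

Lemma Re_inner_le x y : `|complex.Re (inner H x y)| <= hnorm x * hnorm y.
Proof.
have [->|y0] := eqVneq y 0; first by rewrite linear0r hnorm0 mulr0 normr0.
have q0 : 0 < hnorm y ^+ 2.
  rewrite exprn_gt0// lt_neqAle hnorm_ge0 andbT eq_sym.
  by apply: contra y0 => /eqP/hnorm_eq0->.
set b := complex.Re _.
suff h : b ^+ 2 <= (hnorm x * hnorm y) ^+ 2.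
  rewrite -(@ler_pXn2r _ 2) ?nnegrE ?mulr_ge0 ?hnorm_ge0//.
  by rewrite real_normK ?num_real.
(* The minimiser of [hnorm (x + t y)] over real [t]; real multiples are enough because only the real
   part of the inner product is to be bounded. *)
pose t := - b / hnorm y ^+ 2.
have := sqr_ge0 (hnorm (x + (t%:C)%C *: y)).
rewrite sqr_hnormD hnormZ linearZr_LR /= conjCE /= oppr0.
have -> : complex.Re ((t +i* 0)%C * inner H x y) = t * b.
  by rewrite /b; case: (inner H x y) => u v /=; ring.
rewrite expr0n addr0 sqrtr_sqr exprMn real_normK ?num_real// => h.
have : 0 <= (hnorm x ^+ 2 + t ^+ 2 * hnorm y ^+ 2 + 2 * (t * b)) * hnorm y ^+ 2.
  by rewrite mulr_ge0// ltW.
have y00 : hnorm y != 0 by move: q0; rewrite exprn_even_gt0.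
have -> : (hnorm x ^+ 2 + t ^+ 2 * hnorm y ^+ 2 + 2 * (t * b)) * hnorm y ^+ 2
   = (hnorm x * hnorm y) ^+ 2 - b ^+ 2.
  by rewrite /t; field.
by rewrite subr_ge0.
Qed.

Lemma hnormD x y : hnorm (x + y) <= hnorm x + hnorm y.
Proof.
rewrite -(@ler_pXn2r _ 2) ?nnegrE ?addr_ge0 ?hnorm_ge0//.
rewrite sqr_hnormD sqrrD.
have := le_trans (ler_norm _) (Re_inner_le x y); lra.
Qed.

Lemma hnormN x : hnorm (- x) = hnorm x.
Proof. by rewrite -scaleN1r hnormZ normcN normc1 mul1r. Qed.

Lemma hnormB x y : hnorm (x - y) <= hnorm x + hnorm y.
Proof. by rewrite -(hnormN y) hnormD. Qed.

Lemma hdistC x y : hnorm (x - y) = hnorm (y - x).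
Proof. by rewrite -hnormN opprB. Qed.

Lemma hnorm_sum (I : Type) (r : seq I) (P : pred I) (F : I -> H) :
  hnorm (\sum_(i <- r | P i) F i) <= \sum_(i <- r | P i) hnorm (F i).
Proof.
elim/big_ind2 : _ => //; first by rewrite hnorm0.
by move=> u v s t h1 h2; rewrite (le_trans (hnormD _ _))// lerD.
Qed.

Lemma opnorm_le (T : H -> H) (M : R) : 0 <= M ->
  (forall x, hnorm (T x) <= M * hnorm x) -> (opnorm T <= M%:E)%E.
Proof.
move=> M0 h; apply: ge_ereal_sup => _ [x x1 <-]; rewrite lee_fin.
by rewrite (le_trans (h x))// ler_piMr.
Qed.

Lemma hnorm_le_opnorm (T : {linear H -> H}) (M : R) x :
  (opnorm T <= M%:E)%E -> hnorm (T x) <= M * hnorm x.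
Proof.
move=> h; have [->|x0] := eqVneq x 0; first by rewrite linear0 hnorm0 mulr0.
have q0 : 0 < hnorm x.
  rewrite lt_neqAle hnorm_ge0 andbT eq_sym.
  by apply: contra x0 => /eqP/hnorm_eq0->.
have e : normc (((hnorm x)^-1)%:C)%C = (hnorm x)^-1.
  by rewrite /= expr0n addr0 sqrtr_sqr ger0_norm// invr_ge0 ltW.
have : ((hnorm (T ((((hnorm x)^-1)%:C)%C *: x)))%:E <= M%:E)%E.
  apply: le_trans h; apply: ereal_sup_ubound; exists ((((hnorm x)^-1)%:C)%C *: x) => //=.
  by rewrite hnormZ e mulVf// gt_eqF.
by rewrite lee_fin linearZ /= hnormZ e mulrC ler_pdivrMr.
Qed.

End HilbertNorm.

(** * Existence of f(U, V) for absolutely summable Fourier coefficients *)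

Section FunUnitary.
Context {R : realType} {H : hilbertType R}.
Variables (f : torus_fun R) (U V : unitary H).

Lemma hnorm_unitary (W : unitary H) (x : H) : hnorm (W x) = hnorm x.
Proof. by rewrite /hnorm /norm_of uadjP uadjK. Qed.

Lemma hnorm_uadj (W : unitary H) (x : H) : hnorm (uadj W x) = hnorm x.
Proof. by rewrite -(hnorm_unitary W) uopK. Qed.

Lemma hnorm_upow (W : unitary H) j (x : H) : hnorm (upow W j x) = hnorm x.
Proof.
case: j => n /=; first by elim: n => //= n <-; rewrite hnorm_unitary.
by rewrite hnorm_uadj; elim: n => //= n <-; rewrite hnorm_uadj.
Qed.

Lemma upow_is_linear (W : unitary H) j : linear (upow W j).
Proof.
case: j => n a x y /=.
  by elim: n => //= n ->; rewrite linearP.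
rewrite -linearP; congr (uadj W _).
by elim: n => //= n ->; rewrite linearP.
Qed.

Lemma fun_partial_is_linear F : linear (fun_partial f U V F).
Proof.
move=> a x y; rewrite /fun_partial scaler_sumr -big_split /=; apply: eq_bigr => j _.
by rewrite !upow_is_linear scalerDr !scalerA mulrC.
Qed.

Let nf j : R := normc (fourier f j).
Let S F : R := \sum_(j <- enum_fset F) nf j.

Lemma big_fset_sub (M : nmodType) (F G : {fset int * int}) (a : int * int -> M) :
  (F `<=` G)%fset -> \sum_(j <- G) a j =
  \sum_(j <- F) a j + \sum_(j <- (G `\` F)%fset) a j.
Proof.
move=> FG; rewrite (big_fsetID _ (mem F)) /=; congr (_ + _).
  by apply: eq_fbigl => j; rewrite !inE /= andbC; apply/andb_idr => /(fsubsetP FG).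
by apply: eq_fbigl => j; rewrite !inE /= andbC.
Qed.

Lemma fun_partial_sub F G x : (F `<=` G)%fset ->
  hnorm (fun_partial f U V G x - fun_partial f U V F x) <= (S G - S F) * hnorm x.
Proof.
move=> FG; rewrite /fun_partial /S !(big_fset_sub _ FG) addrC addKr addrC addKr.
rewrite (le_trans (hnorm_sum _ _ _))// mulr_suml ler_sum// => j _.
by rewrite hnormZ !hnorm_upow.
Qed.

Hypothesis bnd : exists B : R, forall F : {fset int * int},
  \sum_(j <- F) normc (fourier f j) <= B.

Lemma fun_unitary_ex : exists A : {linear H -> H}, is_fun_unitary f U V A.
Proof.
pose E := [set S F | F in [set: {fset int * int}]]%classic.
have supE : has_sup E.
  split; first by exists (S fset0); exists fset0.
  by case: bnd => B hB; exists B => _ [F _ <-]; exact: hB.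
(* The supremum of the absolute sums replaces the net of finite sets by a sequence: outside the
   chosen set, less than [1 / (n + 1)] of the total mass remains. *)
have exF n : exists G : {fset int * int}, forall F : {fset int * int},
    S F - S G < n.+1%:R^-1.
  have n0 : (0 : R) < n.+1%:R^-1 by rewrite invr_gt0.
  have [_ [G _ <-] hG] := sup_adherent n0 supE.
  exists G => F; rewrite ltrBlDr.
  have /le_lt_trans : S F <= sup E by apply: ub_le_sup; [case: supE | exists F].
  by apply; rewrite -ltrBlDl.
have [Fn hFn] := boolp.choice exF.
pose fp := fun_partial f U V.
(* Neither set need contain the other, so both partial sums are compared with the one over the
   union. *)
have close n (F G : {fset int * int}) x : (forall K, S K - S F <= n.+1%:R^-1) ->
    forall m, (forall K, S K - S G <= m.+1%:R^-1) ->
    hnorm (fp F x - fp G x) <= (n.+1%:R^-1 + m.+1%:R^-1) * hnorm x.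
  move=> hF m hG; pose K := (F `|` G)%fset.
  have hFK := fun_partial_sub x (fsubsetUl F G).
  have hGK := fun_partial_sub x (fsubsetUr F G).
  have -> : fp F x - fp G x = (fp K x - fp G x) - (fp K x - fp F x).
    by rewrite opprB [RHS]addrC addrA subrK.
  rewrite (le_trans (hnormB _ _))// mulrDl addrC lerD//.
    by rewrite (le_trans hFK)// ler_wpM2r ?hnorm_ge0.
  by rewrite (le_trans hGK)// ler_wpM2r ?hnorm_ge0.
have hFn' n K : S K - S (Fn n) <= n.+1%:R^-1 by exact/ltW/hFn.
have arch (C e : R) : 0 <= C -> 0 < e -> exists N, forall n, (N <= n)%N ->
    n.+1%:R^-1 * C < e.
  move=> C0 e0; exists (Num.truncn (C / e)) => n Nn.
  rewrite mulrC ltr_pdivrMr// -ltr_pdivrMl// mulrC.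
  rewrite (lt_le_trans (truncnS_gt _))// ler_nat//.
have Acvg x : exists l : H, forall e : R, 0 < e -> exists N : nat, forall n : nat,
       (N <= n)%N -> hnorm (fp (Fn n) x - l) < e.
  apply: hcomplete => e e0.
  have e20 : 0 < e / 2 by rewrite divr_gt0.
  have [N hN] := arch _ _ (hnorm_ge0 x) e20.
  exists N => m n mN nN.
  rewrite (le_lt_trans (close _ _ _ _ (hFn' m) _ (hFn' n)))// mulrDl.
  by rewrite [ltRHS]splitr ltrD// hN.
have [A hA] := boolp.choice Acvg.
have hA' x y : (forall e, 0 < e -> exists N : nat, forall n : nat,
       (N <= n)%N -> hnorm (fp (Fn n) x - y) < e) -> A x = y.
  move=> hy; apply/eqP; rewrite -subr_eq0; apply/eqP/hnorm_eq0.
  apply/eqP; rewrite eq_le hnorm_ge0 andbT; apply/ler_addgt0Pr => e e0.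
  have e20 : 0 < e / 2 by rewrite divr_gt0.
  have [N1 h1] := hy _ e20; have [N2 h2] := hA x _ e20.
  have := h1 _ (leq_maxl N1 N2); have := h2 _ (leq_maxr N1 N2).
  set z := fp _ x; rewrite (_ : A x - y = (z - y) - (z - A x)); last first.
    by rewrite opprB [RHS]addrC addrA subrK.
  by have := hnormB (z - y) (z - A x); lra.
have linA : linear A.
  move=> a x y; apply: hA' => e e0.
  pose e' := e / (normc a + 1) / 2.
  have a0 : 0 < normc a + 1 by rewrite ltr_wpDl ?normc_ge0.
  have e'0 : 0 < e' by rewrite !divr_gt0.
  have [N1 h1] := hA x _ e'0; have [N2 h2] := hA y _ e'0.
  exists (maxn N1 N2) => n; rewrite geq_max => /andP[n1 n2].
  rewrite /fp fun_partial_is_linear opprD addrACA -scalerBr.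
  rewrite (le_lt_trans (hnormD _ _))// hnormZ.
  have := h1 n n1; have := h2 n n2; set u := hnorm _; set v := hnorm _ => hu hv.
  have -> : e = normc a * e' + e' + (normc a + 1) * e'.
    by rewrite /e'; field; exact: lt0r_neq0.
  have : normc a * v <= normc a * e' by rewrite ler_wpM2l ?normc_ge0// ltW.
  have : 0 < (normc a + 1) * e' by rewrite mulr_gt0.
  lra.
pose A' : {linear H -> H} := HB.pack A (GRing.isLinear.Build _ _ _ _ A linA).
exists A' => e e0.
have [n hn] := arch 1 e ler01 e0; have {}hn := hn n (leqnn n).
exists (Fn n) => F sF.
have hF K : S K - S F <= n.+1%:R^-1.
  rewrite (le_trans _ (hFn' n K))// lerD2l lerN2 -subr_ge0.
  rewrite /S (big_fset_sub _ sF) addrAC subrr add0r sumr_ge0// => j _.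
  exact: normc_ge0.
apply: (@opnorm_le _ _ (fun x => A x - fp F x)); first exact: ltW.
move=> x; apply: (@le_trans _ _ (n.+1%:R^-1 * hnorm x)); last first.
  by rewrite ler_wpM2r ?hnorm_ge0// ltW// -(mulr1 (_^-1)).
apply/ler_addgt0Pr => d d0.
have d20 : 0 < d / 2 by rewrite divr_gt0.
have [N1 h1] := hA x _ d20; have [N2 h2] := arch _ _ (hnorm_ge0 x) d20.
have := h1 _ (leq_maxl N1 N2); have := h2 _ (leq_maxr N1 N2).
set m := maxn _ _; have := close _ _ _ x hF _ (hFn' m).
set z := fp (Fn m) x; rewrite (_ : A x - fp F x = (A x - z) + (z - fp F x)); last first.
  by rewrite addrA subrK.
rewrite mulrDl; have := hnormD (A x - z) (z - fp F x).
rewrite (hdistC z (A x)) (hdistC z (fp F x)).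
by move: (n.+1%:R^-1 * _) (m.+1%:R^-1 * _) => u v; lra.
Qed.

End FunUnitary.

(** * Bounds for sums of powers of singular values *)

Section Schatten.
Context {R : realType} {H : hilbertType R}.
Implicit Types (T K : {linear H -> H}).

Lemma opnorm_ge0 (f : H -> H) : (0 <= opnorm f)%E.
Proof.
apply: (@le_trans _ _ (hnorm (f 0))%:E); first by rewrite lee_fin hnorm_ge0.
by apply: ereal_sup_ubound; exists 0 => //=; rewrite hnorm0.
Qed.

Lemma singular_value_ge0 T n : (0 <= singular_value T n)%E.
Proof. by apply/ereal_infP => _ [K _ <-]; exact: opnorm_ge0. Qed.

(** [rank_le] asks for a family indexed by exactly [k] ordinals; a family over a smaller finite type
    is padded with zeros. *)
Lemma rank_le_fin (J : finType) (b : J -> H) (c : H -> J -> R[i]) K k :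
  (#|J| <= k)%N -> (forall x, K x = \sum_j c x j *: b j) -> rank_le k K.
Proof.
move=> Jk hK; exists (fun i => nth 0 (map b (enum J)) i) => x.
exists (fun i => nth 0 (map (c x) (enum J)) i).
rewrite hK; pose F i := nth 0 (map (c x) (enum J)) i *: nth 0 (map b (enum J)) i.
transitivity (\sum_(i < #|J|) F i).
  rewrite (reindex (@enum_val J J)) /=; last first.
    by exists enum_rank => i _; [rewrite enum_valK|rewrite enum_rankK].
  apply: eq_bigr => i _; rewrite /F.
  have j0 : J := enum_val i.
  have iJ : (i < size (enum J))%N by rewrite -cardE.
  have -> : enum_val i = nth j0 (enum J) i by exact: enum_val_nth.
  by rewrite (nth_map j0 0 (c x) iJ) (nth_map j0 0 b iJ).
rewrite (big_ord_widen_cond k predT F)// big_mkcond /=; apply: eq_bigr => i _.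
case: ifPn => //; rewrite -leqNgt => iJ; rewrite [X in X *: _]nth_default ?scale0r//.
by rewrite size_map -cardE.
Qed.

Lemma singular_value_le T K k (d : R) : rank_le k K -> (opnorm (T \- K)%R <= d%:E)%E ->
  (singular_value T k <= d%:E)%E.
Proof. by move=> rK h; apply: ge_ereal_inf; exists (opnorm (T \- K)) => //; exists K. Qed.

(** The stretch of indices from [B n] to [B n.+1] contributes at most its length times [d n] to the
    power [p]. Strict growth of [B] gives [n <= B n], so the stretches exhaust all indices. *)
Lemma schatten_sum_lt (p : R) (B : nat -> nat) (d : nat -> R) T (M : R) :
  0 <= p -> B 0 = 0%N -> (forall n, (B n < B n.+1)%N) -> (forall n, 0 <= d n) ->
  (forall n k, (B n <= k)%N -> (singular_value T k <= (d n)%:E)%E) ->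
  (forall n, \sum_(m < n) (B m.+1 - B m)%:R * (d m `^ p) <= M) ->
  (\sum_(0 <= n <oo) (singular_value T n `^ p) < +oo)%E.
Proof.
move=> p0 B0 Bi d0 hs hM.
have part n : (\sum_(0 <= k < B n) (singular_value T k `^ p) <=
    (\sum_(m < n) (B m.+1 - B m)%:R * (d m `^ p))%:E)%E.
  elim: n => [|n IH]; first by rewrite B0 big_nil big_ord0.
  rewrite (big_cat_nat (n := B n))//=; last exact: ltnW.
  rewrite big_ord_recr /= EFinD; apply: leeD => //.
  apply: (@le_trans _ _ (\sum_(B n <= k < B n.+1) (d n `^ p)%:E)%E).
    rewrite !big_nat; apply: lee_sum => k /andP[nk _].
    rewrite -poweR_EFin; apply: gt0_ler_poweR => //.
    - by rewrite in_itv /= singular_value_ge0 leey.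
    - by rewrite in_itv /= lee_fin d0 leey.
    - exact: hs.
  by rewrite sumEFin sumr_const_nat mulr_natl.
have nB n : (n <= B n)%N by elim: n => // n IH; exact: leq_ltn_trans IH (Bi n).
apply: (@le_lt_trans _ _ M%:E); last exact: ltry.
apply: lime_le.
  by apply: is_cvg_nneseries => n _ _; exact: poweR_ge0.
apply: nearW => n; apply: (@le_trans _ _ (\sum_(0 <= k < B n) (singular_value T k `^ p))%E).
  rewrite [leRHS](big_cat_nat (n := n))//= leeDl// sume_ge0// => k _.
  exact: poweR_ge0.
by apply: le_trans (part n) _; rewrite lee_fin.
Qed.

Lemma schatten_sum_ge (p : R) T (r : nat) (d : R) : 0 <= p -> 0 <= d ->
  (forall k, (k < r)%N -> (d%:E <= singular_value T k)%E) ->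
  ((r%:R * (d `^ p))%:E <= \sum_(0 <= n <oo) (singular_value T n `^ p))%E.
Proof.
move=> p0 d0 h; apply: le_trans (nneseries_lim_ge r _); last first.
  by move=> n _ _; exact: poweR_ge0.
apply: (@le_trans _ _ (\sum_(0 <= k < r) (d `^ p)%:E)%E).
  by rewrite sumEFin sumr_const_nat subn0 mulr_natl.
rewrite !big_nat; apply: lee_sum => k /andP[_ kr].
rewrite -poweR_EFin; apply: gt0_ler_poweR => //.
- by rewrite in_itv /= lee_fin d0 leey.
- by rewrite in_itv /= singular_value_ge0 leey.
- exact: h.
Qed.

End Schatten.

(** * The space l2 and its weighted permutations *)

Section l2.
Variables (R : realType) (T : nat -> finType).
Local Notation I := {n : nat & T n}.
Local Notation C := R[i].

Definition idx n (t : T n) : I := existT T n t.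

(** Squared norm of the [n]-th block. Grouping coordinates into finite blocks turns sums over the
    disjoint union into ordinary series over [n]. *)
Definition bsq (x : I -> C) (n : nat) : R := \sum_(t : T n) normc (x (idx t)) ^+ 2.

Lemma fctDZ a (x y : I -> C) i : (a *: x + y) i = a * x i + y i.
Proof. by []. Qed.

Lemma fctB (x y : I -> C) i : (x - y) i = x i - y i.
Proof. by []. Qed.

Definition l2_pred (x : I -> C) : bool :=
  `[< exists B : R, forall n, series (bsq x) n <= B >].

Lemma bsq_ge0 x n : 0 <= bsq x n.
Proof. by apply: sumr_ge0 => t _; exact: sqr_ge0. Qed.

Lemma l2_predP x : reflect (exists B : R, forall n, series (bsq x) n <= B) (l2_pred x).
Proof. exact: asboolP. Qed.

Lemma l2_cvg x : l2_pred x -> cvgn (series (bsq x)).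
Proof. by case/l2_predP => B; apply: bounded_series_cvg; exact: bsq_ge0. Qed.

Lemma cvg_l2 x : cvgn (series (bsq x)) -> l2_pred x.
Proof.
move=> c; apply/l2_predP; exists (limn (series (bsq x))) => n.
by apply: series_le_lim => //; exact: bsq_ge0.
Qed.

Lemma l2_pred_le (c : R) x y : (forall n, bsq x n <= c * bsq y n) ->
  l2_pred y -> l2_pred x.
Proof.
move=> h /l2_cvg cy; apply/cvg_l2.
apply: (@series_le_cvg _ _ (c *: bsq y)) => //; first exact: bsq_ge0.
  by move=> n; apply: le_trans (h n); exact: bsq_ge0.
exact: is_cvg_seriesZ.
Qed.

Lemma bsqD x y n : bsq (x + y) n <= 2 * bsq x n + 2 * bsq y n.
Proof.
rewrite /bsq !mulr_sumr -big_split /=; apply: ler_sum => t _.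
rewrite -[(x + y) (idx t)]/(x (idx t) + y (idx t)) !normc_sqr.
case: (x _) (y _) => [a b] [c d] /=.
have := sqr_ge0 (a - c); have := sqr_ge0 (b - d); lra.
Qed.

Lemma bsqZ a x n : bsq (a *: x) n = normc a ^+ 2 * bsq x n.
Proof.
rewrite /bsq mulr_sumr; apply: eq_bigr => t _.
by rewrite -[(a *: x) (idx t)]/(a * x (idx t)) normcM exprMn.
Qed.

Lemma l2_submod_closed : submod_closed l2_pred.
Proof.
split.
  apply/l2_predP; exists 0 => n; rewrite /series/= big1// => k _.
  by rewrite /bsq big1// => t _; rewrite normc0 expr0n.
move=> a x y lx ly; apply/cvg_l2.
apply: (@series_le_cvg _ _ (2 *: (bsq (a *: x) + bsq y))) => //.
- exact: bsq_ge0.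
- by move=> n; rewrite mulr_ge0// addr_ge0// bsq_ge0.
- by move=> n; rewrite (le_trans (bsqD _ _ _))// -mulrDr.
apply: is_cvg_seriesZ; apply: is_cvg_seriesD; last exact: l2_cvg.
apply: l2_cvg; apply: (l2_pred_le (c := normc a ^+ 2)) lx => n.
by rewrite bsqZ.
Qed.

HB.instance Definition _ := GRing.isSubmodClosed.Build C (I -> C) l2_pred l2_submod_closed.

Record l2 := L2 { l2val :> I -> C; l2P : l2val \in l2_pred }.
HB.instance Definition _ := [isSub for l2val].
HB.instance Definition _ := [Choice of l2 by <:].
HB.instance Definition _ := [SubChoice_isSubLmodule of l2 by <:].

Implicit Types x y z : l2.

Lemma l2D x y i : (x + y) i = x i + y i. Proof. by []. Qed.
Lemma l2B x y i : (x - y) i = x i - y i. Proof. by []. Qed.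
Lemma l2Z a x i : (a *: x) i = a * x i. Proof. by []. Qed.
Lemma l2_sum (J : Type) (r : seq J) (P : pred J) (F : J -> l2) i :
  (\sum_(j <- r | P j) F j) i = \sum_(j <- r | P j) F j i.
Proof. by elim/big_ind2 : _ => // u v s t; rewrite l2D => -> ->. Qed.

Lemma l2_ext x y : (forall n (t : T n), x (idx t) = y (idx t)) -> x = y.
Proof. by move=> h; apply/val_inj/funext => -[n t]; exact: h. Qed.

Definition bre x y n : R := \sum_(t : T n) complex.Re (x (idx t) * (y (idx t))^*%C).
Definition bim x y n : R := \sum_(t : T n) complex.Im (x (idx t) * (y (idx t))^*%C).

Lemma l2_inner_bound x y n :
  (`|bre x y n| <= bsq x n + bsq y n) /\ (`|bim x y n| <= bsq x n + bsq y n).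
Proof.
suff h (c : C -> R) : (forall u, `|c u| <= normc u) ->
  `|\sum_(t : T n) c (x (idx t) * (y (idx t))^*%C)| <= bsq x n + bsq y n.
  by split; apply: h => u; [exact: ler_Re_normc|exact: ler_Im_normc].
move=> hc; rewrite (le_trans (ler_norm_sum _ _ _))// /bsq -big_split/= ler_sum// => t _.
rewrite (le_trans (hc _))// normcM normc_conj.
have := sqr_ge0 (normc (x (idx t)) - normc (y (idx t))).
have := sqr_ge0 (normc (x (idx t)) + normc (y (idx t))).
lra.
Qed.

Lemma bre_cvg x y : cvgn (series (bre x y)).
Proof.
apply: (abs_series_cvg (v := bsq x + bsq y)).
  by move=> n; case: (l2_inner_bound x y n).
by apply: is_cvg_seriesD; apply/l2_cvg/l2P.
Qed.

Lemma bim_cvg x y : cvgn (series (bim x y)).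
Proof.
apply: (abs_series_cvg (v := bsq x + bsq y)).
  by move=> n; case: (l2_inner_bound x y n).
by apply: is_cvg_seriesD; apply/l2_cvg/l2P.
Qed.

Definition l2_inner x y : C := (limn (series (bre x y)) +i* limn (series (bim x y)))%C.

Lemma l2_inner_herm x y : l2_inner x y = (-1) ^+ false * Num.conj (l2_inner y x).
Proof.
rewrite expr0 mul1r conjCE /l2_inner /=; congr Complex.
  rewrite (_ : bre x y = bre y x)//; apply/funext => n; apply: eq_bigr => t _.
  by case: (x _) (y _) => [a b] [c d] /=; ring.
rewrite (lim_series_lin (a := -1) (b := 0) (c := 0) (@bim_cvg y x)
  (@bim_cvg y x) (@bim_cvg y x) (s := bim x y)); last first.
  move=> n; rewrite !mul0r !addr0 /bim mulr_sumr; apply: eq_bigr => t _.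
  by case: (x _) (y _) => [a b] [c d] /=; ring.
ring.
Qed.

Lemma l2_innerDZ a x z y :
  l2_inner (a *: x + z) y = a * l2_inner x y + l2_inner z y.
Proof.
case: a => a1 a2; apply/eqP; rewrite eq_complex /=; apply/andP; split; apply/eqP.
  rewrite (lim_series_lin (a := a1) (b := - a2) (c := 1) (@bre_cvg x y)
    (@bim_cvg x y) (@bre_cvg z y)); first ring.
  move=> n; rewrite /bre /bim !mulr_sumr -!big_split /=; apply: eq_bigr => t _.
  rewrite fctDZ; case: (x _) (y _) (z _) => [a b] [c d] [e f] /=; ring.
rewrite (lim_series_lin (a := a1) (b := a2) (c := 1) (@bim_cvg x y)
    (@bre_cvg x y) (@bim_cvg z y)); first ring.
move=> n; rewrite /bre /bim !mulr_sumr -!big_split /=; apply: eq_bigr => t _.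
rewrite fctDZ; case: (x _) (y _) (z _) => [a b] [c d] [e f] /=; ring.
Qed.

Lemma l2_inner_linl y : scalar (l2_inner ^~ y).
Proof. by move=> a x z; exact: l2_innerDZ. Qed.

Lemma l2_inner_linr x : linear_for (Num.conj \; *%R) (l2_inner x).
Proof.
move=> a y z; rewrite l2_inner_herm expr0 mul1r l2_innerDZ rmorphD rmorphM /=.
by rewrite (l2_inner_herm x y) (l2_inner_herm x z) !expr0 !mul1r.
Qed.

Lemma bre_xx x n : bre x x n = bsq x n.
Proof.
apply: eq_bigr => t _; rewrite normc_sqr; case: (x _) => a b /=; ring.
Qed.

Lemma l2_innerxx x : l2_inner x x = ((limn (series (bsq x)))%:C)%C.
Proof.
rewrite /l2_inner; congr Complex.
  by congr (limn (series _)); apply/funext => n; exact: bre_xx.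
rewrite (_ : bim x x = cst 0).
  rewrite (_ : series _ = cst 0) ?lim_cst//.
  by apply/funext => n; rewrite /series /= big1.
apply/funext => n; rewrite /bim big1// => t _; case: (x _) => a b /=; ring.
Qed.

Lemma bsq_coord x n (t : T n) : normc (x (idx t)) ^+ 2 <= bsq x n.
Proof. by rewrite /bsq (bigD1 t)//= lerDl sumr_ge0// => s _; exact: sqr_ge0. Qed.

Lemma bsq_le_lim x n : bsq x n <= limn (series (bsq x)).
Proof.
have b0 := bsq_ge0 x.
apply: (le_trans _ (series_le_lim n.+1 b0 (l2_cvg (l2P x)))).
by rewrite /series /= big_nat_recr//= lerDr sumr_ge0.
Qed.

Lemma l2_inner_pos x : x != 0 -> 0 < l2_inner x x.
Proof.
move=> x0; rewrite l2_innerxx ltcR.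
have [[n t] xnt] : exists i, x i != 0.
  apply/not_existsP => h; move/eqP: x0; apply; apply: l2_ext => n t.
  by apply/eqP/negP => /negP/h.
apply: lt_le_trans (bsq_le_lim x n); apply: lt_le_trans (bsq_coord x t).
rewrite exprn_gt0// lt_neqAle normc_ge0 andbT eq_sym.
by apply: contra xnt => /eqP/eq0_normc->.
Qed.

HB.instance Definition _ := @bilinear_isBilinear.Build C l2 l2 C *%R
  (Num.conj \; *%R) l2_inner (conj l2_inner_linl l2_inner_linr).
HB.instance Definition _ := @isHermitianSesquilinear.Build C l2 false Num.conj
  l2_inner l2_inner_herm.
HB.instance Definition _ := @isDotProduct.Build C l2 l2_inner l2_inner_pos.

Definition l2_dot : {dot l2 for Num.conj} := l2_inner.

Lemma l2_norm_of x : norm_of l2_dot x = Num.sqrt (limn (series (bsq x))).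
Proof. by rewrite /norm_of [l2_dot x x]l2_innerxx. Qed.

End l2.

Section l2_hilbert.
Variables (R : realType) (T : nat -> finType).
Local Notation I := {n : nat & T n}.
Local Notation C := R[i].
Local Notation l2 := (l2 R T).

Lemma sqr_norm_of_l2 (x : l2) : norm_of (l2_dot R T) x ^+ 2 = limn (series (bsq x)).
Proof.
rewrite l2_norm_of sqr_sqrtr//.
apply: (le_trans (bsq_ge0 x 0)); exact: bsq_le_lim.
Qed.

Lemma coord_le_norm (x : l2) n (t : T n) : normc (x (idx t)) <= norm_of (l2_dot R T) x.
Proof.
rewrite -(@ler_pXn2r _ 2) ?nnegrE ?normc_ge0 ?sqrtr_ge0//.
rewrite sqr_norm_of_l2; apply: (le_trans _ (bsq_le_lim x n)); exact: bsq_coord.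
Qed.

(** The candidate is the coordinatewise limit [y]. In a sum over finitely many blocks the limit
    [j -> oo] can be taken in the Cauchy estimate for [u m - u j]; the resulting bound for [u m - y]
    does not depend on the number of blocks. *)
Lemma l2_complete (u : nat -> l2) :
  (forall e : R, 0 < e -> exists N : nat, forall m n : nat,
     (N <= m)%N -> (N <= n)%N -> norm_of (l2_dot R T) (u m - u n) < e) ->
  exists l : l2, forall e : R, 0 < e -> exists N : nat, forall n : nat,
     (N <= n)%N -> norm_of (l2_dot R T) (u n - l) < e.
Proof.
move=> cu.
have cRe n (t : T n) : cvgn (fun k => complex.Re (u k (idx t))).
  apply: cauchy_seq_cvg => e e0; have [N hN] := cu e e0; exists N => j k Nj Nk.
  apply: le_lt_trans (hN j k Nj Nk); apply: le_trans (coord_le_norm _ t).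
  apply: le_trans (ler_Re_normc _); rewrite l2B.
  by case: (u j _) (u k _) => [a b] [c d].
have cIm n (t : T n) : cvgn (fun k => complex.Im (u k (idx t))).
  apply: cauchy_seq_cvg => e e0; have [N hN] := cu e e0; exists N => j k Nj Nk.
  apply: le_lt_trans (hN j k Nj Nk); apply: le_trans (coord_le_norm _ t).
  apply: le_trans (ler_Im_normc _); rewrite l2B.
  by case: (u j _) (u k _) => [a b] [c d].
pose y (i : I) : C := (limn (fun k => complex.Re (u k i)) +i*
                       limn (fun k => complex.Im (u k i)))%C.
have cvg_bsq m k : (series (bsq (u m - u j)) k @[j --> \oo] -->
    series (bsq ((u m : I -> C) - y)) k)%classic.
  rewrite /series /=; apply: cvg_big => [|n _]; first exact: add_continuous.
  rewrite /bsq; apply: cvg_big => [|t _]; first exact: add_continuous.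
  rewrite (_ : (fun j => _) = (fun j =>
    (complex.Re (u m (idx t)) - complex.Re (u j (idx t))) ^+ 2 +
    (complex.Im (u m (idx t)) - complex.Im (u j (idx t))) ^+ 2)); last first.
    apply/funext => j; rewrite fctB normc_sqr.
    by case: (u m _) (u j _) => [a b] [c d].
  rewrite fctB normc_sqr.
  have -> : complex.Re (u m (idx t) - y (idx t)) =
    complex.Re (u m (idx t)) - limn (fun k => complex.Re (u k (idx t))).
    by rewrite /y; case: (u m _) => a b.
  have -> : complex.Im (u m (idx t) - y (idx t)) =
    complex.Im (u m (idx t)) - limn (fun k => complex.Im (u k (idx t))).
    by rewrite /y; case: (u m _) => a b.
  by apply: cvgD; exact: cvg_sqr_dist.
have bnd (e : R) : 0 < e -> exists N, forall m, (N <= m)%N -> forall k,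
    series (bsq ((u m : I -> C) - y)) k <= e ^+ 2.
  move=> e0; have [N hN] := cu e e0; exists N => m Nm k.
  rewrite -(cvg_lim (@Rhausdorff R) (cvg_bsq m k)).
  apply: limr_le; first by apply/cvg_ex; eexists; exact: cvg_bsq.
  exists N => // j /= Nj; pose z : l2 := u m - u j.
  have := series_le_lim k (bsq_ge0 z) (l2_cvg (l2P z)).
  move=> /le_trans; apply.
  by rewrite -sqr_norm_of_l2 ler_pXn2r ?nnegrE ?sqrtr_ge0 ?(ltW e0)// ltW// hN.
have [N0 hN0] := bnd 1 ltr01.
have ly : y \in @l2_pred R T.
  have -> : y = (u N0 : I -> C) - ((u N0 : I -> C) - y) by rewrite opprB addrC subrK.
  apply: rpredB; first exact: l2P.
  by apply/l2_predP; exists (1 ^+ 2) => k; exact: hN0.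
exists (L2 ly) => e e0.
have e20 : 0 < e / 2 by rewrite divr_gt0.
have [N hN] := bnd _ e20; exists N => m Nm.
apply: (@le_lt_trans _ _ (e / 2)); last by rewrite ltr_pdivrMr// ltr_pMr// ltr1n.
rewrite -(@ler_pXn2r _ 2) ?nnegrE ?sqrtr_ge0 ?(ltW e20)//.
rewrite sqr_norm_of_l2; apply: lim_le_series; first by apply/l2_cvg/l2P.
by move=> k; exact: hN.
Qed.

Definition hl2 : hilbertType R := HilbertType l2_complete.

Lemma sqr_hnorm_l2 (x : hl2) : hnorm x ^+ 2 = limn (series (bsq (x : l2))).
Proof. exact: sqr_norm_of_l2. Qed.

Lemma hl2DZ a (x y : hl2) (i : I) : (a *: x + y : l2) i = a * (x : l2) i + (y : l2) i.
Proof. by []. Qed.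

Lemma bsq_le_hnorm (x : hl2) n : bsq (x : l2) n <= hnorm x ^+ 2.
Proof. by rewrite sqr_hnorm_l2; exact: bsq_le_lim. Qed.

Lemma coord_le_hnorm (x : hl2) n (t : T n) : normc ((x : l2) (idx t)) <= hnorm x.
Proof. exact: coord_le_norm. Qed.

Lemma hnorm_l2_le (c : R) (x y : hl2) : 0 <= c ->
  (forall n, bsq (x : l2) n <= c ^+ 2 * bsq (y : l2) n) -> hnorm x <= c * hnorm y.
Proof.
move=> c0 h; rewrite -(@ler_pXn2r _ 2) ?nnegrE ?mulr_ge0 ?hnorm_ge0//.
rewrite exprMn !sqr_hnorm_l2; apply: lim_le_series; first by apply/l2_cvg/l2P.
move=> n; have := series_le_lim n (bsq_ge0 (y : l2)) (l2_cvg (l2P y)).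
move=> /(ler_wpM2l (sqr_ge0 c)); apply: le_trans.
by rewrite /series /= mulr_sumr; apply: ler_sum => k _.
Qed.

Lemma hnorm_single n (x : hl2) : (forall m, m != n -> bsq (x : l2) m = 0) ->
  hnorm x ^+ 2 <= bsq (x : l2) n.
Proof.
move=> h; rewrite sqr_hnorm_l2; apply: lim_le_series; first by apply/l2_cvg/l2P.
move=> k; rewrite /series /=; case: (ltnP n k) => nk.
  by rewrite (bigD1_seq n) ?mem_index_iota ?iota_uniq//= big1 ?addr0.
rewrite big_nat big1 ?bsq_ge0// => i /andP[_ ik]; apply: h.
by rewrite neq_ltn (leq_trans ik nk).
Qed.

Lemma bsq_delta (i : I) n : bsq (fun j => (i == j)%:R : C) n = (tag i == n)%:R.
Proof.
case: i => m s; rewrite /bsq /=; have [mn|mn] := eqVneq m n; last first.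
  by rewrite big1// => t _; rewrite -tag_eqE /tag_eq /= (negbTE mn) normc0 expr0n.
subst n; rewrite (bigD1 s)//= big1 ?addr0.
  by rewrite eqxx normc1 expr1n.
move=> t ts; rewrite -tag_eqE /tag_eq /= eqxx /= tagged_asE eq_sym (negbTE ts).
by rewrite normc0 expr0n.
Qed.

Lemma delta_l2 (i : I) : (fun j => (i == j)%:R : C) \in @l2_pred R T.
Proof.
apply/l2_predP; exists 1 => n; rewrite /series /=.
under eq_bigr do rewrite bsq_delta.
case: (ltnP (tag i) n) => ni.
  rewrite (bigD1_seq (tag i)) ?mem_index_iota ?iota_uniq//= eqxx big1 ?addr0// => j.
  by rewrite eq_sym => /negbTE->.
rewrite big_nat big1 // => j /andP[_ jn].
by rewrite gtn_eqF// (leq_trans jn ni).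
Qed.

Definition delta (i : I) : l2 := L2 (delta_l2 i).

Lemma hnorm_delta_comb n (J : finType) (g : J -> T n) (a : J -> C) : injective g ->
  hnorm (\sum_j a j *: delta (idx (g j)) : hl2) ^+ 2 <= \sum_j normc (a j) ^+ 2.
Proof.
move=> gi; set x := \sum_j _.
have xE (i : I) : (x : l2) i = \sum_j a j * (idx (g j) == i)%:R.
  by rewrite /x l2_sum; apply: eq_bigr.
apply: le_trans (hnorm_single (n := n) _) _.
  move=> m mn; rewrite /bsq big1// => t _; rewrite xE big1 ?normc0 ?expr0n// => j _.
  by rewrite -tag_eqE /tag_eq /= eq_sym (negbTE mn) mulr0.
rewrite /bsq (bigID [in g @: J]) /= [X in _ + X]big1 ?addr0; last first.
  move=> t /imsetP tg; rewrite xE big1 ?normc0 ?expr0n// => j _.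
  rewrite -tag_eqE /tag_eq /= eqxx /= tagged_asE; case: eqP => [e|]; last by rewrite mulr0.
  by exfalso; apply: tg; exists j.
rewrite big_imset /=; last by move=> ? ? _ _; exact: gi.
apply: ler_sum => j _; rewrite xE (bigD1 j)//= eqxx mulr1 big1 ?addr0// => k kj.
rewrite -tag_eqE /tag_eq /= eqxx /= tagged_asE.
by rewrite (inj_eq gi) (negbTE kj) mulr0.
Qed.

End l2_hilbert.

Section WeightedPermutation.
Variables (R : realType) (T : nat -> finType).
Local Notation I := {n : nat & T n}.
Local Notation C := R[i].
Local Notation l2 := (l2 R T).
Local Notation H := (hl2 R T).

(** Data of an operator [x |-> (i |-> a i * x (s i))] preserving every block. Blocks are finite, so
    injectivity already makes the shift a permutation and allows reindexing along it. *)
Record wperm := WPerm {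
  wweight : I -> C;
  wbound : R;
  wshift : forall n, T n -> T n;
  wbound_ge0 : 0 <= wbound;
  wweight_le : forall i, normc (wweight i) <= wbound;
  wshift_inj : forall n, injective (@wshift n) }.

Variable w : wperm.

Definition wfun (x : l2) (i : I) : C :=
  wweight w i * x (idx (wshift w (tagged i))).

Lemma bsq_wfun_le (c : R) (x : l2) n : 0 <= c ->
  (forall t : T n, normc (wweight w (idx t)) <= c) ->
  bsq (wfun x) n <= c ^+ 2 * bsq x n.
Proof.
move=> c0 hc; rewrite /bsq [X in _ <= _ * X](reindex_inj (@wshift_inj w n)) mulr_sumr.
apply: ler_sum => t _; rewrite /wfun normcM exprMn ler_wpM2r ?sqr_ge0//.
by rewrite ler_pXn2r ?nnegrE ?normc_ge0.
Qed.

Lemma wfun_l2 (x : l2) : wfun x \in @l2_pred R T.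
Proof.
apply: (l2_pred_le (c := wbound w ^+ 2)) (l2P x) => n.
by apply: bsq_wfun_le => [|t]; [exact: wbound_ge0|exact: wweight_le].
Qed.

Definition wop_fun (x : H) : H := L2 (wfun_l2 x).

Lemma wop_linear : linear wop_fun.
Proof.
move=> a x y; apply: l2_ext => n t; rewrite l2D l2Z /= /wfun.
by rewrite hl2DZ mulrDr mulrCA.
Qed.

HB.instance Definition _ := GRing.isLinear.Build C H H *:%R wop_fun wop_linear.

Definition wop : {linear H -> H} := wop_fun.

Lemma wopE (x : H) (i : I) :
  (wop x : l2) i = wweight w i * (x : l2) (idx (wshift w (tagged i))).
Proof. by []. Qed.

Lemma hnorm_wop (x : H) (c : R) : 0 <= c -> (forall i, normc (wweight w i) <= c) ->
  hnorm (wop x) <= c * hnorm x.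
Proof. by move=> c0 hc; apply: hnorm_l2_le => // n; apply: bsq_wfun_le. Qed.

End WeightedPermutation.

Section UnitaryWeightedPermutation.
Variables (R : realType) (T : nat -> finType).
Local Notation I := {n : nat & T n}.
Local Notation C := R[i].
Local Notation l2 := (l2 R T).
Local Notation H := (hl2 R T).
Variables (a : I -> C) (s s' : forall n, T n -> T n).
Hypothesis a1 : forall i, normc (a i) = 1.
Hypothesis sK : forall n, cancel (@s n) (@s' n).
Hypothesis s'K : forall n, cancel (@s' n) (@s n).

Let ale i : normc (a i) <= 1. Proof. by rewrite a1. Qed.

Definition wforth := WPerm ler01 ale
  (fun n => can_inj (@sK n)).

Let b (i : I) : C := ((a (idx (s' (tagged i))))^*)%C.

Let ble i : normc (b i) <= 1. Proof. by rewrite /b normc_conj a1. Qed.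

Definition wback := WPerm ler01 ble
  (fun n => can_inj (@s'K n)).

Lemma wperm_adj (x y : H) : inner H (wop wforth x) y = inner H x (wop wback y).
Proof.
rewrite /= /l2_inner; congr Complex; congr (limn (series _)); apply/funext => n.
  rewrite /bre (reindex_inj (can_inj (@s'K n))); apply: eq_bigr => t _.
  rewrite /wop_fun /= /wfun /= s'K /b /=.
  by case: (a _) (l2val x _) (l2val y _) => [p q] [c d] [e f] /=; ring.
rewrite /bim (reindex_inj (can_inj (@s'K n))); apply: eq_bigr => t _.
rewrite /wop_fun /= /wfun /= s'K /b /=.
by case: (a _) (l2val x _) (l2val y _) => [p q] [c d] [e f] /=; ring.
Qed.

Lemma wforthK (x : H) : wop wback (wop wforth x) = x.
Proof.
apply: l2_ext => n t; rewrite !wopE /= s'K mulrA [_^*%C * _]mulrC.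
by rewrite mul_conjc_unit ?mul1r.
Qed.

Lemma wbackK (x : H) : wop wforth (wop wback x) = x.
Proof.
by apply: l2_ext => n t; rewrite !wopE /= /b /= sK mulrA mul_conjc_unit ?mul1r.
Qed.

Definition wunitary : unitary H := Unitary wperm_adj wforthK wbackK.

Lemma wunitaryE (x : H) (i : I) :
  (wunitary x : l2) i = a i * (x : l2) (idx (s (tagged i))).
Proof. by []. Qed.

(** The operator pulls functions back along [s], hence moves basis vectors along the inverse [s']. A
    forward shift of basis vectors is thus obtained from the predecessor map. *)
Lemma wunitary_delta n (t : T n) :
  wunitary (delta R (idx t)) = a (idx (s' t)) *: (delta R (idx (s' t)) : H).
Proof.
apply: l2_ext => m u; rewrite wunitaryE l2Z /=.
have [e|] := eqVneq (idx t) (idx (s u)).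
  have mn : n = m by exact: (congr1 tag e).
  subst n; have -> : t = s u by apply: eq_from_Tagged e.
  by rewrite sK eqxx.
rewrite mulr0; have [e|_ _] := eqVneq (idx (s' t)) (idx u); last by rewrite mulr0.
have mn : n = m by exact: (congr1 tag e).
by subst n; have <- : s' t = u by [apply: eq_from_Tagged e]; rewrite s'K eqxx.
Qed.

End UnitaryWeightedPermutation.

(** * Singular values of operators on a direct sum of finite blocks *)

Section Schatten_l2.
Variables (R : realType) (S : nat -> finType).
Local Notation I := {n : nat & S n}.
Local Notation C := R[i].
Local Notation l2 := (l2 R S).
Local Notation H := (hl2 R S).

(** Cutting the weights down to the blocks below [N] leaves an operator whose rank is at most the
    total size of these blocks; the remainder has all its weights bounded by [d]. *)
Lemma singular_value_wop_le (T : {linear H -> H}) (w : wperm R S) (N k : nat) (d : R) :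
  (forall x, T x = wop w x) -> 0 <= d ->
  (forall n (t : S n), (N <= n)%N -> normc (wweight w (idx t)) <= d) ->
  (\sum_(m < N) #|S m| <= k)%N -> (singular_value T k <= d%:E)%E.
Proof.
move=> hT d0 hd Nk.
have cut_le (P : pred I) i : normc (if P i then wweight w i else 0) <= wbound w.
  by case: ifP => _; [exact: wweight_le|rewrite normc0 wbound_ge0].
pose low (i : I) := (tag i < N)%N.
pose wl := WPerm (wbound_ge0 w) (cut_le low) (@wshift_inj _ _ w).
pose wh := WPerm (wbound_ge0 w) (cut_le (predC low)) (@wshift_inj _ _ w).
have Tl x : T x - wop wl x = wop wh x.
  rewrite hT; apply: l2_ext => n t; rewrite -scaleN1r addrC hl2DZ !wopE /= /low /=.
  by case: ifP => _ /=; rewrite mul0r; ring.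
apply: (@singular_value_le _ _ _ (wop wl)); last first.
  apply: opnorm_le => // x; rewrite [(_ \- _) x]Tl; apply: hnorm_wop => // -[n t].
  have -> : wweight wh (existT S n t) = if (n < N)%N then 0 else wweight w (idx t).
    by rewrite /= /low /=; case: ltnP.
  case: ltnP => Nn; first by rewrite normc0.
  exact: hd.
apply: (@rank_le_fin R H _ (fun j : {m : 'I_N & S m} => delta R (idx (tagged j)) : H)
  (fun (x : H) j => (wop wl x : l2) (idx (tagged j))) (wop wl) k).
  rewrite card_tagged sumnE big_map big_enum /=.
  by apply: leq_trans Nk; rewrite (eq_bigr (fun m : 'I_N => #|S m|)).
move=> x; apply: l2_ext => n t; rewrite l2_sum.
under eq_bigr do rewrite l2Z.
have [nN|Nn] := ltnP n N; last first.
  rewrite [LHS]wopE /= /low /= ltnNge Nn mul0r big1// => -[[m mN] s] _ /=.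
  rewrite -tag_eqE /tag_eq /=; case: eqVneq => [e|]; last by rewrite mulr0.
  by exfalso; move: (mN); rewrite e ltnNge Nn.
rewrite (bigD1 (existT (fun m : 'I_N => S m) (Ordinal nN) t))//= eqxx mulr1.
rewrite big1 ?addr0// => -[[m mN] s] /= ms.
case: eqP => [e|]; last by rewrite mulr0.
exfalso; move/eqP: ms; apply.
have mn : m = n := congr1 tag e.
subst m; have -> : s = t by apply: eq_from_Tagged e.
by rewrite (bool_irrelevance mN nN).
Qed.

(** An operator given by [k < r] vectors annihilates a nontrivial combination of the [r] basis
    vectors at the [g c], while [T] reproduces its coefficients, times [z], at the coordinates
    [h c]. The other coordinates of the image can only increase its norm, so nothing is asked of
    them. *)
Lemma singular_value_ge (T : {linear H -> H}) n (r k : nat) (g h : 'I_r -> S n)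
    (z : C) : injective g -> injective h -> 0 < normc z ->
  (forall c c', (T (delta R (idx (g c))) : l2) (idx (h c')) = (c == c')%:R * z) ->
  (k < r)%N -> ((normc z)%:E <= singular_value T k)%E.
Proof.
move=> gi hi z0 hT kr; apply/ereal_infP => _ [K [b hb] <-].
rewrite leNgt; apply/negP => lt.
have [s s0 [sz hs]] : exists2 s : R, 0 <= s & s < normc z /\ (opnorm (T \- K)%R <= s%:E)%E.
  have := opnorm_ge0 (T \- K).
  case: (opnorm (T \- K)) lt => [u|//|//]; rewrite lte_fin lee_fin => uz u0.
  by exists u.
have [M hM] := boolp.choice (fun c => hb (delta R (idx (g c)))).
pose A : 'M[C]_(r, k) := \matrix_(c, l) M c l.
have [v v0 vA] : exists2 v : 'rV[C]_r, v != 0 & v *m A = 0.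
  have : kermx A != 0.
    rewrite -mxrank_eq0 mxrank_ker subn_eq0 -ltnNge.
    exact: leq_ltn_trans (rank_leq_col A) kr.
  by case/rowV0Pn => v /sub_kermxP vA v0; exists v.
pose x : H := \sum_c v 0 c *: (delta R (idx (g c)) : H).
have Kx : K x = 0.
  rewrite linear_sum /=; under eq_bigr do rewrite linearZ /= hM scaler_sumr.
  rewrite exchange_big /= big1// => l _.
  under eq_bigr do rewrite scalerA.
  rewrite -scaler_suml (_ : \sum_c _ = 0) ?scale0r//.
  transitivity ((v *m A) 0 l); last by rewrite vA mxE.
  by rewrite mxE; apply: eq_bigr => c _; rewrite mxE.
have Tx : hnorm (T x) <= s * hnorm x.
  by have := hnorm_le_opnorm x hs; rewrite [X in hnorm X](_ : _ = T x - K x)// Kx subr0.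
pose Q := \sum_c normc (v 0 c) ^+ 2.
have Q0 : 0 < Q.
  rewrite lt_neqAle sumr_ge0 ?andbT; last by move=> c _; exact: sqr_ge0.
  apply: contra v0; rewrite eq_sym psumr_eq0; last by move=> c _; exact: sqr_ge0.
  move=> /allP h0; apply/eqP/rowP => c; rewrite mxE.
  have := h0 c (mem_index_enum c); rewrite sqrf_eq0 => /eqP.
  exact: eq0_normc.
have xQ : hnorm x ^+ 2 <= Q by exact: hnorm_delta_comb.
have TQ : normc z ^+ 2 * Q <= hnorm (T x) ^+ 2.
  apply: le_trans (bsq_le_hnorm _ n).
  rewrite /bsq (bigID [in h @: 'I_r]) /= big_imset /=; last by move=> ? ? _ _; exact: hi.
  apply: ler_wpDr; first by apply: sumr_ge0 => t _; exact: sqr_ge0.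
  rewrite /Q mulr_sumr; apply: ler_sum => c _.
  suff -> : (T x : l2) (idx (h c)) = v 0 c * z by rewrite normcM exprMn mulrC.
  rewrite linear_sum l2_sum (bigD1 c)//= linearZ l2Z hT eqxx mul1r big1 ?addr0// => c' cc.
  by rewrite linearZ l2Z hT (negbTE cc) mul0r mulr0.
have : normc z ^+ 2 * Q <= s ^+ 2 * Q.
  apply: le_trans TQ _; apply: (@le_trans _ _ (s ^+ 2 * hnorm x ^+ 2)).
    by rewrite -exprMn ler_pXn2r ?nnegrE ?mulr_ge0 ?hnorm_ge0.
  by rewrite ler_wpM2l ?sqr_ge0.
rewrite ler_pM2r// ler_pXn2r ?nnegrE ?normc_ge0// leNgt => /negP; exact.
Qed.

End Schatten_l2.

(** * Fourier coefficients of absolutely convergent series on the torus *)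

Section Trig.
Local Open Scope classical_set_scope.
Local Open Scope ring_scope.
Context {R : realType}.
Implicit Types (b : int) (c t : R).

Lemma sin_period c b : sin (c + b%:~R * (2 * pi)) = sin c :> R.
Proof.
have e : 2 * pi = pi *+ 2 :> R by rewrite mulr_natl.
rewrite e; case: b => n.
  by rewrite -pmulrn mulr_natl (periodicn (@sinD2pi R)).
rewrite NegzE mulrNz -pmulrn mulNr mulr_natl -[LHS](periodicn (@sinD2pi R) n.+1).
by rewrite subrK.
Qed.

Lemma norm_sin_le (x : R) : 0 <= x -> `|sin x| <= x.
Proof.
move=> x0.
have dsin y : y \in `]0, x[ -> is_derive y 1 sin (cos y) by move=> _; exact: is_derive_sin.
have csin : {within `[0, x], continuous (@sin R)}.
  by apply: continuous_subspaceT; exact: continuous_sin.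
have [c _] := MVT_segment x0 dsin csin; rewrite sin0 !subr0 => ->.
by rewrite normrM (ger0_norm x0) ler_piMl// cos_max.
Qed.

Lemma integral_cos c b : b != 0 ->
  (\int[@lebesgue_measure R]_(t in `[0%R, (2 * pi)%R]) (cos (c + b%:~R * t))%:E = 0%E)%E.
Proof.
move=> b0; have b0' : (b%:~R : R) != 0 by rewrite intr_eq0.
pose F t : R := (b%:~R)^-1 * sin (c + b%:~R * t).
have dF t : is_derive t 1 F (cos (c + b%:~R * t)).
  apply: is_derive_eq.
  by rewrite /GRing.scale /=; field.
have cF : continuous F.
  by move=> t; apply: differentiable_continuous; apply/derivable1_diffP; case: (dF t).
have cf : continuous (fun t : R => cos (c + b%:~R * t)).
  move=> t; apply: continuous_comp; last exact: continuous_cos.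
  by apply: cvgD; [exact: cvg_cst|apply: cvgM; [exact: cvg_cst|exact: cvg_id]].
rewrite (@continuous_FTC2 _ _ F).
- by rewrite /F sin_period mulr0 addr0 subee.
- by rewrite mulr_gt0 ?pi_gt0.
- exact: continuous_subspaceT.
- split; first by move=> t _; case: (dF t).
    by apply: cvg_at_right_filter; exact: cF.
  by apply: cvg_at_left_filter; exact: cF.
- by move=> t _; rewrite derive1E; case: (dF t).
Qed.

End Trig.

Section Square.
Local Open Scope classical_set_scope.
Local Open Scope ring_scope.
Context {R : realType}.
Local Notation mR := (measurableTypeR R).
Local Notation mu := (@lebesgue_measure R).
Local Notation Q := (`[0%R : R, (2 * pi)%R]%classic : set mR).

Lemma squareE : @square R = Q `*` Q.
Proof.
by apply/seteqP; split => -[s t] /=; rewrite /square /= !in_itv.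
Qed.

Lemma measurable_square : measurable (@square R).
Proof. by rewrite squareE; apply: measurableX; exact: measurable_itv. Qed.

Lemma leb2_square : leb2 R (@square R) = ((2 * pi) ^+ 2)%:E.
Proof.
rewrite squareE; have -> : leb2 R (Q `*` Q) = (mu Q * mu Q)%E.
  by apply: product_measure1E; exact: measurable_itv.
rewrite lebesgue_measure_itv /= lte_fin mulr_gt0 ?pi_gt0//.
by rewrite -EFinB subr0 -EFinM expr2.
Qed.

Lemma bounded_integrable_square (h : mR * mR -> R) (M : R) :
  measurable_fun setT h -> (forall x, `|h x| <= M) ->
  (leb2 R).-integrable (@square R) (EFin \o h).
Proof.
move=> mh hM; apply: measurable_bounded_integrable.
- exact: measurable_square.
- by rewrite leb2_square ltry.
- exact: measurable_funTS.
- exists M; split; first exact: num_real.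
  by move=> y My x _ /=; rewrite (le_trans (hM x))// ltW.
Qed.

Lemma Rintegral_square (h : mR * mR -> R) (M : R) :
  measurable_fun setT h -> (forall x, `|h x| <= M) ->
  (\int[leb2 R]_(x in @square R) (h x)%:E =
   \int[mu]_(s in Q) \int[mu]_(t in Q) (h (s, t))%:E)%E.
Proof.
move=> mh hM; have ih := bounded_integrable_square mh hM.
rewrite integral_mkcond.
have ih' := (integrable_mkcond (mu := leb2 R) (EFin \o h) measurable_square).1 ih.
rewrite -[LHS](integral12_prod_meas1 ih') [RHS]integral_mkcond.
apply: eq_integral => s _; rewrite /fubini_F.
rewrite patchE; case: ifPn => sQ.
  rewrite [RHS]integral_mkcond; apply: eq_integral => t _.
  rewrite !patchE squareE; have -> : ((s, t) \in Q `*` Q) = (t \in Q) => //.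
  by rewrite in_setX /= sQ.
apply: integral0_eq => t _; rewrite patchE squareE.
by rewrite in_setX /= (negbTE sQ).
Qed.

Lemma measurable_wave (a b : int) (c : R) :
  measurable_fun setT (fun x : mR * mR => cos (a%:~R * x.1 + b%:~R * x.2 + c)).
Proof.
apply: (measurableT_comp (f := cos)).
  by apply: continuous_measurable_fun; exact: continuous_cos.
apply: measurable_funD => //; apply: measurable_funD.
  by apply: measurable_funM => //; exact: measurable_fst.
by apply: measurable_funM => //; exact: measurable_snd.
Qed.

(** The phase handles cosine ([c = 0]) and sine ([c = - (pi / 2)]) together, that is, the real and
    imaginary parts of a monomial. *)
Lemma integral_wave (a b : int) (c : R) :
  (\int[leb2 R]_(x in @square R) (cos (a%:~R * x.1 + b%:~R * x.2 + c))%:E =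
   (((2 * pi) ^+ 2 * cos c) *+ ((a, b) == (0, 0)))%:E)%E.
Proof.
rewrite (@Rintegral_square (fun x => cos (a%:~R * x.1 + b%:~R * x.2 + c)) 1);
  [|exact: measurable_wave|by move=> x; exact: cos_max].
have mQ : mu Q = (2 * pi)%:E.
  by rewrite lebesgue_measure_itv /= lte_fin mulr_gt0 ?pi_gt0// -EFinB subr0.
have mQoo : (mu Q < +oo)%E by rewrite mQ ltry.
have [->|b0] := eqVneq b 0; last first.
  rewrite xpair_eqE (negbTE b0) andbF integral0_eq// => s _ /=.
  under eq_integral do rewrite addrAC.
  exact: integral_cos.
under eq_integral => s _.
  under eq_integral do rewrite /= mul0r addr0 addrC.
  rewrite integral_cst; last exact: measurable_itv.
  rewrite [X in (_ * X)%E](_ : _ = (2 * pi)%:E); last exact: mQ.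
  over.
have [->|a0] := eqVneq a 0.
  under eq_integral do rewrite mul0r addr0.
  rewrite eqxx integral_cst; last exact: measurable_itv.
  rewrite [X in (_ * X)%E](_ : _ = (2 * pi)%:E); last exact: mQ.
  by rewrite -!EFinM mulr1n; congr EFin; ring.
rewrite xpair_eqE (negbTE a0) /=.
under eq_integral do rewrite muleC.
rewrite integralZl; last 2 first.
- exact: measurable_itv.
- apply: measurable_bounded_integrable.
  + exact: measurable_itv.
  + exact: mQoo.
  + apply: measurable_funTS; apply: continuous_measurable_fun => t.
    apply: continuous_comp; last exact: continuous_cos.
    by apply: cvgD; [exact: cvg_cst|apply: cvgM; [exact: cvg_cst|exact: cvg_id]].
  + exists 1; split => // y y1 x _ /=; exact: le_trans (cos_max _) (ltW y1).
transitivity ((2 * pi)%:E * 0 : \bar R)%E; last by rewrite mule0.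
by congr (_ * _)%E; exact: integral_cos.
Qed.

End Square.

Section WaveSeries.
Local Open Scope classical_set_scope.
Local Open Scope ring_scope.
Context {R : realType}.
Local Notation mR := (measurableTypeR R).
Variables (N : nat -> nat) (alpha : nat -> nat -> R).
Hypothesis calpha : cvgn (series (fun n => \sum_(k < N n) `|alpha n k|)).

Definition wave (e : nat -> nat -> int * int) (c : R) (n : nat) (x : mR * mR) : R :=
  \sum_(k < N n) alpha n k * cos ((e n k).1%:~R * x.1 + (e n k).2%:~R * x.2 + c).

Lemma wave_le e c n x : `|wave e c n x| <= \sum_(k < N n) `|alpha n k|.
Proof.
rewrite (le_trans (ler_norm_sum _ _ _))// ler_sum// => k _.
by rewrite normrM ler_piMr// cos_max.
Qed.

Lemma wave_cvg e c x : cvgn (series (wave e c ^~ x)).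
Proof. by apply: (abs_series_cvg _ calpha) => n; exact: wave_le. Qed.

Let B := limn (series (fun n => \sum_(k < N n) `|alpha n k|)).

Lemma wave_series_le e c x n : `|series (wave e c ^~ x) n| <= B.
Proof.
apply: le_trans (series_le_lim n _ calpha); last first.
  by move=> m; apply: sumr_ge0.
rewrite /series /= (le_trans (ler_norm_sum _ _ _))// ler_sum// => k _.
exact: wave_le.
Qed.

Lemma measurable_wave_sum e c n : measurable_fun setT (wave e c n).
Proof.
apply: measurable_sum => k; apply: measurable_funM => //; exact: measurable_wave.
Qed.

Lemma measurable_wave_series e c n :
  measurable_fun setT (fun x => series (wave e c ^~ x) n).
Proof. by apply: measurable_sum => k; exact: measurable_wave_sum. Qed.

Definition wave_lim e c (x : mR * mR) : R := limn (series (wave e c ^~ x)).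

Lemma wave_lim_le e c x : `|wave_lim e c x| <= B.
Proof.
rewrite ler_norml; apply/andP; split.
  apply: limr_ge; first exact: wave_cvg.
  by apply: nearW => n; have := wave_series_le e c x n; rewrite ler_norml => /andP[].
apply: limr_le; first exact: wave_cvg.
by apply: nearW => n; have := wave_series_le e c x n; rewrite ler_norml => /andP[].
Qed.

Lemma measurable_wave_lim e c : measurable_fun setT (wave_lim e c).
Proof.
apply: (measurable_fun_cvg (h := fun n x => series (wave e c ^~ x) n)).
  by move=> n; exact: measurable_wave_series.
by move=> x _; exact: wave_cvg.
Qed.

Lemma integrable_wave_lim e c :
  (leb2 R).-integrable (@square R) (EFin \o wave_lim e c).
Proof.
apply: bounded_integrable_square (measurable_wave_lim e c) _ => x.
exact: wave_lim_le.
Qed.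

Definition wave_int (e : nat -> nat -> int * int) (c : R) (n : nat) : R :=
  \sum_(k < N n) alpha n k * (((2 * pi) ^+ 2 * cos c) *+ (e n k == (0, 0))).

Lemma integral_wave_sum e c n :
  (\int[leb2 R]_(x in @square R) (wave e c n x)%:E = (wave_int e c n)%:E)%E.
Proof.
under eq_integral do rewrite /wave -sumEFin.
rewrite integral_sum; [|exact: measurable_square|].
  rewrite /wave_int -sumEFin; apply: eq_bigr => k _.
  under eq_integral do rewrite EFinM.
  rewrite integralZl; [|exact: measurable_square|].
    by rewrite integral_wave -surjective_pairing EFinM.
  apply: bounded_integrable_square (measurable_wave _ _ _) _ => x.
  exact: cos_max.
move=> k; apply: (bounded_integrable_square (M := `|alpha n k|)).
  by apply: measurable_funM => //; exact: measurable_wave.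
by move=> x; rewrite normrM ler_piMr// cos_max.
Qed.

Lemma wave_int_cvg e c : cvgn (series (wave_int e c)).
Proof.
apply: (abs_series_cvg (v := (2 * pi) ^+ 2 *:
  (fun n => \sum_(k < N n) `|alpha n k|))); last exact: is_cvg_seriesZ.
move=> n; rewrite (le_trans (ler_norm_sum _ _ _))//.
rewrite [leRHS]mulr_sumr ler_sum// => k _.
rewrite normrM mulrC ler_wpM2r//; case: eqP => _; rewrite ?mulr0n ?normr0 ?sqr_ge0//.
by rewrite mulr1n normrM ger0_norm ?sqr_ge0// ler_piMr ?sqr_ge0// cos_max.
Qed.

(** Dominated convergence: the partial sums are bounded by the constant [B], which is integrable on
    the square. *)
Lemma Rintegral_wave_lim e c :
  \int[leb2 R]_(x in @square R) (wave_lim e c x) = limn (series (wave_int e c)).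
Proof.
have dom := @dominated_cvg _ _ R (leb2 R) _ measurable_square
  (fun n x => (series (wave e c ^~ x) n)%:E) (EFin \o wave_lim e c) (cst B%:E).
have {}dom : (\int[leb2 R]_(x in @square R) (series (wave e c ^~ x) n)%:E)%E @[n --> \oo]
    --> (\int[leb2 R]_(x in @square R) (wave_lim e c x)%:E)%E.
  apply: dom.
  - move=> n; apply: measurable_funTS; apply/measurable_EFinP.
    exact: measurable_wave_series.
  - by move=> x _; apply: cvg_EFin; [exact: nearW|exact: wave_cvg].
  - by [].
  - apply: (bounded_integrable_square (h := cst B) (M := `|B|)) => //.
  - by move=> n x _; rewrite /= lee_fin wave_series_le.
rewrite /Rintegral -(cvg_lim (@ereal_hausdorff R) dom).
rewrite (_ : (fun n => _) = EFin \o series (wave_int e c)).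
  by rewrite EFin_lim//; exact: wave_int_cvg.
apply/funext => n /=; rewrite /series /= -sumEFin.
under eq_integral do rewrite -sumEFin.
rewrite integral_sum; [|exact: measurable_square|].
  by apply: eq_bigr => k _; rewrite integral_wave_sum.
move=> k; apply: bounded_integrable_square (measurable_wave_sum e c k) _ => x.
exact: wave_le.
Qed.

End WaveSeries.

Section TorusSeries.
Local Open Scope classical_set_scope.
Local Open Scope ring_scope.
Context {R : realType}.

Definition tmono (j : int * int) : torus_fun R :=
  fun z1 z2 => val z1 ^ j.1 * val z2 ^ j.2.

Lemma expi_exprn (t : R) n :
  (val (expi t) ^+ n = cos (n%:R * t) +i* sin (n%:R * t))%C.
Proof.
elim: n => [|n IH]; first by rewrite mul0r cos0 sin0 expr0.
rewrite exprS IH /= -natr1 mulrDl mul1r cosD sinD.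
by apply/eqP; rewrite eq_complex /=; apply/andP; split; apply/eqP; ring.
Qed.

Lemma expi_exprz (t : R) (a : int) :
  (val (expi t) ^ a = cos (a%:~R * t) +i* sin (a%:~R * t))%C.
Proof.
case: a => n; first by rewrite -pmulrn; exact: expi_exprn.
rewrite NegzE -exprnN expi_exprn mulrNz -pmulrn mulNr cosN sinN /GRing.inv /=.
by rewrite cos2Dsin2 !divr1.
Qed.

Lemma tmono_expi j (s t : R) : tmono j (expi s) (expi t) =
  (cos (j.1%:~R * s + j.2%:~R * t) +i* sin (j.1%:~R * s + j.2%:~R * t))%C.
Proof.
rewrite /tmono !expi_exprz cosD sinD.
by apply/eqP; rewrite eq_complex /=; apply/andP; split; apply/eqP; ring.
Qed.

Lemma circle_neq0 (z : circle R) : val z != 0.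
Proof.
case: z => z /= /eqP z1; apply/negP => /eqP z0.
by move: z1; rewrite z0 normr0 => /esym/eqP; rewrite oner_eq0.
Qed.

Lemma normc_circle (z : circle R) : normc (val z) = 1.
Proof. by case: z => z /= /eqP; rewrite -[X in X = _ -> _]/((normc z)%:C)%C => -[]. Qed.

Lemma normc_exprz (z : circle R) a : normc (val z ^ a) = 1.
Proof.
have h n : normc (val z ^+ n) = 1.
  by elim: n => [|n IH]; rewrite ?normc1// exprS normcM IH normc_circle mulr1.
by case: a => n; [exact: h | rewrite NegzE -exprnN normcV h invr1].
Qed.

Lemma normc_tmono j z1 z2 : normc (tmono j z1 z2) = 1.
Proof. by rewrite normcM !normc_exprz mulr1. Qed.

Lemma tmonoD i j z1 z2 : tmono i z1 z2 * tmono j z1 z2 = tmono (i.1 + j.1, i.2 + j.2) z1 z2.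
Proof. by rewrite /tmono /= !expfzDr ?circle_neq0// mulrACA. Qed.

Variables (N : nat -> nat) (alpha : nat -> nat -> R) (e : nat -> nat -> int * int).
Hypothesis calpha : cvgn (series (fun n => \sum_(k < N n) `|alpha n k|)).

Definition tblock n : torus_fun R := fun z1 z2 =>
  \sum_(k < N n) (alpha n k)%:C%C * tmono (e n k) z1 z2.

(** Taking limits of real and imaginary parts separately keeps every convergence argument within
    real series. *)
Definition tseries : torus_fun R := fun z1 z2 =>
  (limn (series (fun n => complex.Re (tblock n z1 z2))) +i*
   limn (series (fun n => complex.Im (tblock n z1 z2))))%C.

Let shift (j : int * int) n k : int * int := ((e n k).1 - j.1, (e n k).2 - j.2).

Lemma tblock_le n z1 z2 : normc (tblock n z1 z2) <= \sum_(k < N n) `|alpha n k|.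
Proof.
rewrite (le_trans (normc_sum_le _ _))// ler_sum// => k _.
by rewrite normcM normc_tmono mulr1 normc_R.
Qed.

Lemma tblock_cvg z1 z2 : cvgn (series (fun n => complex.Re (tblock n z1 z2))) /\
  cvgn (series (fun n => complex.Im (tblock n z1 z2))).
Proof.
split; apply: (abs_series_cvg _ calpha) => n; apply: le_trans (tblock_le n z1 z2).
  exact: ler_Re_normc.
exact: ler_Im_normc.
Qed.

(** Multiplication by the conjugate of the monomial [j] translates all frequencies by [-j], so that
    the [j]-th Fourier coefficient becomes a mean value. *)
Lemma tblock_shift j n (x : R * R) :
  tblock n (expi x.1) (expi x.2) * tmono (- j.1, - j.2) (expi x.1) (expi x.2) =
  (wave N alpha (shift j) 0 n x +i* wave N alpha (shift j) (- (pi / 2)) n x)%C.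
Proof.
rewrite /tblock mulr_suml; apply/eqP; rewrite eq_complex /= Re_sum Im_sum /wave.
apply/andP; split; apply/eqP; apply: eq_bigr => k _;
  by rewrite -mulrA tmonoD tmono_expi /= ?addr0 ?cosBpihalf; ring.
Qed.

Lemma tseries_shift j (x : R * R) :
  tseries (expi x.1) (expi x.2) * tmono (- j.1, - j.2) (expi x.1) (expi x.2) =
  (wave_lim N alpha (shift j) 0 x +i* wave_lim N alpha (shift j) (- (pi / 2)) x)%C.
Proof.
have [cRe cIm] := tblock_cvg (expi x.1) (expi x.2).
have h := fun n => tblock_shift j n x.
set m := tmono _ _ _ in h *; rewrite /wave_lim /tseries.
apply/eqP; rewrite eq_complex; apply/andP; split; apply/eqP => /=.
  rewrite [RHS](lim_series_lin (a := complex.Re m) (b := - complex.Im m) (c := 0) cRe cIm cRe).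
    by case: m h => a b /= _; ring.
  move=> n; have := congr1 (@complex.Re R) (h n) => /= <-.
  by case: m h (tblock n _ _) => a b _ [u v] /=; ring.
rewrite [RHS](lim_series_lin (a := complex.Im m) (b := complex.Re m) (c := 0) cRe cIm cRe).
  by case: m h => a b /= _; ring.
move=> n; have := congr1 (@complex.Im R) (h n) => /= <-.
by case: m h (tblock n _ _) => a b _ [u v] /=; ring.
Qed.

Lemma tseries_integrable : torus_integrable tseries.
Proof.
have h (x : R * R) : tseries (expi x.1) (expi x.2) =
    (wave_lim N alpha (shift (0, 0)) 0 x +i* wave_lim N alpha (shift (0, 0)) (- (pi / 2)) x)%C.
  by rewrite -tseries_shift /tmono /= oppr0 !expr0z !mulr1.
split.
  rewrite (_ : (fun x => _) = EFin \o wave_lim N alpha (shift (0, 0)) 0).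
    exact: integrable_wave_lim.
  by apply/funext => x; rewrite h.
rewrite (_ : (fun x => _) = EFin \o wave_lim N alpha (shift (0, 0)) (- (pi / 2))).
  exact: integrable_wave_lim.
by apply/funext => x; rewrite h.
Qed.

Definition tcoef (j : int * int) n : R := \sum_(k < N n | e n k == j) alpha n k.

(** Integration keeps only the terms whose translated frequency is zero. Since the coefficients are
    real, the sine part has mean zero: it carries the factor [cos (- (pi / 2))]. *)
Lemma fourier_tseries j : fourier tseries j = ((limn (series (tcoef j)))%:C)%C.
Proof.
rewrite /fourier /torus_mean.
rewrite (_ : (fun x => _) = wave_lim N alpha (shift j) 0); last first.
  by apply/funext => x; rewrite -/(tmono (- j.1, - j.2) _ _) tseries_shift.
rewrite (_ : (fun x => complex.Im _) = wave_lim N alpha (shift j) (- (pi / 2))); last first.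
  by apply/funext => x; rewrite -/(tmono (- j.1, - j.2) _ _) tseries_shift.
have pi2 : (2 * pi) ^+ 2 != 0 :> R by rewrite expf_neq0// mulf_neq0// gt_eqF// pi_gt0.
rewrite !Rintegral_wave_lim//.
have sh n k : (shift j n k == (0, 0)) = (e n k == j).
  by rewrite /shift; case: (e n k) j => [a b] [c d]; rewrite !xpair_eqE !subr_eq0.
congr Complex.
  have cc : cvgn (series (tcoef j)).
    apply: (abs_series_cvg _ calpha) => n.
    rewrite (le_trans (ler_norm_sum _ _ _))// big_mkcond /=.
    by apply: ler_sum => k _; case: ifP.
  rewrite (lim_series_lin (s := wave_int N alpha (shift j) 0)
    (a := (2 * pi) ^+ 2) (b := 0) (c := 0) cc cc cc) ?mul0r ?addr0.
    by rewrite mulrA mulVf// mul1r.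
  move=> n; rewrite !mul0r !addr0 /wave_int /tcoef mulr_sumr [RHS]big_mkcond /=.
  apply: eq_bigr => k _; rewrite sh cos0 mulr1.
  by case: eqP => _; rewrite ?mulr0n ?mulr0// mulr1n mulrC.
rewrite (_ : series _ = cst 0) ?lim_cst ?mulr0//.
apply/funext => n; rewrite /series /= big1// => m _.
by rewrite /wave_int big1// => k _; rewrite cosN cos_pihalf mulr0 mul0rn mulr0.
Qed.

End TorusSeries.

(** * Cutoff functions and Rudin-Shapiro polynomials *)

Section Cutoff.
Local Open Scope classical_set_scope.
Local Open Scope ring_scope.
Context {R : realType}.
Variables (w : R -> R) (hw : besov_cutoff w).

Lemma cutoff_support t : w t != 0 -> 2^-1 <= t <= 2.
Proof. by case: hw => _ _ h _ wt; apply: (h t); exact: subset_closure. Qed.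

(** The continuous derivative is bounded on [[0, 4]]. This interval contains the support of [w] and
    every argument, at most 2, at which the block estimate compares values of [w]. *)
Lemma cutoff_lipschitz : exists2 C : R, 0 <= C &
  forall s t, 0 <= s <= 4 -> 0 <= t <= 4 -> `|w s - w t| <= C * `|s - t|.
Proof.
case: hw => dw _ _ _.
have cts (f : R -> R) : (forall t, derivable f t 1) -> continuous f.
  by move=> df t; apply: differentiable_continuous; apply/derivable1_diffP.
have cw : continuous w by apply: cts; exact: (dw 0%N).
have cw' : continuous (derive1 w) by apply: cts; exact: (dw 1%N).
have [c _ hc] : exists2 c : R, c \in `[0, 4] &
    forall t, t \in `[0, 4] -> `|(derive1 w) t| <= `|(derive1 w) c|.
  apply: EVT_max => //; apply: continuous_subspaceT => t.
  by apply: continuous_comp; [exact: cw'|exact: norm_continuous].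
exists `|(derive1 w) c| => // s t.
wlog st : s t / s <= t => [h s4 t4|].
  have [/h->//|/ltW/h] := leP s t.
  by rewrite (distrC (w s)) (distrC s); apply.
move=> /andP[s0 s4] /andP[t0 t4]; rewrite (distrC (w s)) (distrC s).
have dws x : x \in `]s, t[ -> is_derive x 1 w (derive1 w x).
  by move=> _; split; [exact: (dw 0%N)|rewrite derive1E].
have cws : {within `[s, t], continuous w} by exact: continuous_subspaceT.
have [u ust ->] := MVT_segment st dws cws.
rewrite normrM ler_wpM2r// hc// in_itv /=.
by move: ust; rewrite in_itv /= => /andP[su ut]; apply/andP; split; lra.
Qed.

Lemma cutoff_bounded : exists2 C : R, 0 <= C & forall t, w t <= C.
Proof.
have [C C0 hC] := cutoff_lipschitz; exists (C * 4); first by rewrite mulr_ge0.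
move=> t; have [->|wt] := eqVneq (w t) 0; first by rewrite mulr_ge0.
have w0 : w 0 = 0.
  by apply/eqP; apply: contraT => /cutoff_support; rewrite invr_le0; lra.
have /andP[t0 t2] := cutoff_support wt.
have t00 : 0 <= t by apply: le_trans t0; rewrite invr_ge0.
have h : `|w t - w 0| <= C * `|t - 0| by apply: hC; apply/andP; split; lra.
rewrite w0 !subr0 (ger0_norm t00) in h.
rewrite (le_trans (ler_norm _))// (le_trans h)// ler_wpM2l//; lra.
Qed.

End Cutoff.

Section RudinShapiro.
Context {R : realType}.

(** Coefficients of the recursion [P' = P + z^(2^a) Q], [Q' = P - z^(2^a) Q]. Only the indices
    [k < 2^a] are meaningful at stage [a], although the values are signs everywhere. *)
Fixpoint rudin_shapiro (a : nat) : (nat -> R) * (nat -> R) :=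
  if a is a'.+1 then
    let: (p, q) := rudin_shapiro a' in
    (fun k => if (k < 2 ^ a')%N then p k else q (k - 2 ^ a')%N,
     fun k => if (k < 2 ^ a')%N then p k else - q (k - 2 ^ a')%N)
  else (fun=> 1, fun=> 1).

Lemma rudin_shapiro_sqr a k :
  (rudin_shapiro a).1 k ^+ 2 = 1 /\ (rudin_shapiro a).2 k ^+ 2 = 1.
Proof.
elim: a k => [|a IH] k /=; first by rewrite expr1n.
case: (rudin_shapiro a) IH => p q /= IH.
have [p1 _] := IH k; have [_ q1] := IH (k - 2 ^ a)%N.
by case: ifP; rewrite ?sqrrN.
Qed.

Let poly (c : nat -> R) n (z : R[i]) : R[i] := \sum_(k < n) (c k)%:C%C * z ^+ k.

(** On the circle [z^(2^a) Q] and [Q] have equal moduli, so the parallelogram law doubles the sum of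
    squares at each stage. *)
Lemma rudin_shapiro_identity a (z : R[i]) : normc z = 1 ->
  normc (poly (rudin_shapiro a).1 (2 ^ a) z) ^+ 2 +
  normc (poly (rudin_shapiro a).2 (2 ^ a) z) ^+ 2 = 2 ^+ a.+1.
Proof.
move=> z1; elim: a => [|a IH].
  by rewrite /poly /= !big_ord1 expr0 mulr1 normc1 expr1n.
rewrite [RHS]exprS -IH.
pose s := z ^+ (2 ^ a) * poly (rudin_shapiro a).2 (2 ^ a) z.
have -> : normc (poly (rudin_shapiro a).2 (2 ^ a) z) = normc s.
  rewrite /s normcM; suff -> : normc (z ^+ (2 ^ a)) = 1 by rewrite mul1r.
  by elim: (2 ^ a)%N => [|n IHn]; rewrite ?normc1// exprS normcM z1 mul1r.
rewrite -normc_parallelogram /= expnS mul2n -addnn /poly !big_split_ord /= /s.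
case: (rudin_shapiro a) => p q /=.
congr (normc _ ^+ 2 + normc _ ^+ 2); congr (_ + _).
- by apply: eq_bigr => k _; rewrite ltn_ord.
- rewrite /poly mulr_sumr; apply: eq_bigr => k _.
  by rewrite ltnNge leq_addr /= addKn exprD mulrCA.
- by apply: eq_bigr => k _; rewrite ltn_ord.
- rewrite /poly mulr_sumr -sumrN; apply: eq_bigr => k _.
  by rewrite ltnNge leq_addr /= addKn exprD rmorphN mulNr mulrCA.
Qed.

(** The even index makes the number of coefficients the square of [2^b], so its square root is again
    a power of 2. *)
Lemma rudin_shapiro_flat b (z : R[i]) : normc z = 1 ->
  normc (poly (rudin_shapiro (2 * b)).1 (2 ^ (2 * b)) z) <= 2 * 2 ^+ b.
Proof.
move=> /(rudin_shapiro_identity (2 * b)) h.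
rewrite -(@ler_pXn2r _ 2) ?nnegrE ?normc_ge0 ?mulr_ge0 ?exprn_ge0//.
apply: (@le_trans _ _ (2 ^+ (2 * b).+1)); first by rewrite -h lerDl sqr_ge0.
rewrite exprS exprMn -exprM mulnC ler_wpM2r ?exprn_ge0//.
by rewrite expr2 ler_pMr// ler1n.
Qed.

End RudinShapiro.

(** * The test function and its Besov norm *)

Section Scales.
Variable K : nat.
Hypothesis K0 : (0 < K)%N.
Local Open Scope nat_scope.

(** [2 ^ bexp n] is the square root of [width n]. The factor 5 makes the next width [2^(10 b)]
    exceed the degree, which is below [2^(8 b + 1)]; the factor 4 would only make it equal to
    [level n]. The constant [K] is adapted to [p]. *)
Definition bexp n := K * 5 ^ n.
Definition width n := 2 ^ (2 * bexp n).
Definition level n := 2 ^ (8 * bexp n).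
Definition degree n := level n + width n.

Lemma lt_bexp n : n < bexp n.
Proof. by rewrite /bexp (leq_trans (ltn_expl n (isT : 1 < 5)))// leq_pmull. Qed.

Lemma bexpS n : bexp n.+1 = 5 * bexp n.
Proof. by rewrite /bexp expnS mulnCA. Qed.

Lemma bexp_leq m n : m <= n -> bexp m <= bexp n.
Proof. by move=> mn; rewrite leq_pmul2l// leq_exp2l. Qed.

Lemma width_gt1 n : 1 < width n.
Proof. by rewrite /width -{1}(expn0 2) ltn_exp2l// muln_gt0 /= (leq_ltn_trans _ (lt_bexp n)). Qed.

Lemma degree_lt_width n : degree n < width n.+1.
Proof.
rewrite /degree /level /width bexpS.
have b0 := leq_ltn_trans (leq0n n) (lt_bexp n).
apply: (@leq_ltn_trans (2 ^ (8 * bexp n).+1)).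
  by rewrite [leqRHS]expnS [leqRHS]mul2n -[leqRHS]addnn leq_add2l leq_exp2l//; lia.
by rewrite ltn_exp2l//; lia.
Qed.

Lemma width_leq m n : m <= n -> width m <= width n.
Proof. by move=> mn; rewrite leq_exp2l// leq_pmul2l// bexp_leq. Qed.

Lemma width_le_degree n : width n <= degree n.
Proof. exact: leq_addl. Qed.

Lemma degree_ltn m n : m < n -> degree m < width n.
Proof. by move=> mn; apply: leq_trans (degree_lt_width m) (width_leq mn). Qed.

Lemma degree_inj : injective degree.
Proof.
move=> m n; have [mn|nm|//] := ltngtP m n => e.
  by have := leq_trans (degree_ltn mn) (width_le_degree n); rewrite e ltnn.
by have := leq_trans (degree_ltn nm) (width_le_degree m); rewrite e ltnn.
Qed.

Lemma lt_degree n : n < degree n.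
Proof.
apply: (leq_trans _ (width_le_degree n)); apply: (leq_trans (lt_bexp n)).
by rewrite ltnW// (leq_trans (ltn_expl _ (isT : 1 < 2)))// leq_exp2l//; lia.
Qed.

(* Among the homogeneous polynomials of degrees [degree m], only the [n]-th one
   moves position [0] to position [width n] of a cycle of length [2 * width n]. *)
Lemma degree_mod m n : (degree m %% (2 * width n) == width n) = (m == n).
Proof.
have w0 : 0 < width n by rewrite ltnW// width_gt1.
have b0 k := leq_ltn_trans (leq0n k) (lt_bexp k).
(* For a scale beyond [n], both summands of the degree are powers of 2 divisible by the cycle
   length, so the degree is 0 modulo it. At scale [n] itself only [level n] is divisible, which
   leaves [width n]. *)
have dvd k : n < k -> 2 * width n %| width k.
  move=> nk; rewrite /width -expnS dvdn_exp2l//.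
  by have := bexp_leq nk; rewrite bexpS; have := b0 n; lia.
have dvdl k : n <= k -> 2 * width n %| level k.
  move=> nk; rewrite /width /level -expnS dvdn_exp2l//.
  by have := bexp_leq nk; have := b0 n; lia.
have [mn|nm|->] := ltngtP m n.
- have dw := degree_ltn mn; rewrite modn_small; last by lia.
  by apply/negbTE; lia.
- have /eqP -> : 2 * width n %| degree m by rewrite dvdn_addr ?dvdl ?dvd// ltnW.
  by apply/negbTE; lia.
- rewrite /degree -modnDml (eqP (dvdl n (leqnn n))) add0n modn_small ?eqxx//.
  by lia.
Qed.

End Scales.

Section TestFunction.
Local Open Scope classical_set_scope.
Local Open Scope ring_scope.
Context {R : realType}.
Variable K : nat.
Hypothesis K0 : (0 < K)%N.
Local Notation b := (bexp K).
Local Notation N := (width K).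
Local Notation L := (level K).

Definition freq n k : int * int := (Posz (degree K n - k), Posz k).

(* [2 ^- n / (level n * sqrt (width n))] *)
Definition amp n : R := 2 ^- (n + 9 * b n).

Definition coef n k : R := amp n * (rudin_shapiro (2 * b n)).1 k.

Definition testf : torus_fun R := tseries N coef freq.

Lemma amp_gt0 n : 0 < amp n.
Proof. by rewrite invr_gt0 exprn_gt0. Qed.

Lemma norm_coef n k : `|coef n k| = amp n.
Proof.
rewrite /coef normrM gtr0_norm ?amp_gt0//.
have [h _] := @rudin_shapiro_sqr R (2 * b n) k.
have -> : `|(rudin_shapiro (2 * b n)).1 k| = 1 :> R; last by rewrite mulr1.
by apply/eqP; rewrite -(@eqrXn2 _ 2)// real_normK ?num_real// h expr1n.
Qed.

Lemma sum_coef n : \sum_(k < N n) `|coef n k| = 2 ^- (n + 7 * b n).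
Proof.
rewrite (eq_bigr (fun=> amp n)) => [|k _]; last exact: norm_coef.
rewrite sumr_const card_ord -[LHS]mulr_natl /amp /width natrX.
rewrite (_ : (n + 9 * b n = 2 * b n + (n + 7 * b n))%N); last by lia.
by rewrite exprD invfM mulrA divff ?mul1r// expf_neq0.
Qed.

Lemma coef_cvg : cvgn (series (fun n => \sum_(k < N n) `|coef n k|)).
Proof.
apply: (@bounded_series_cvg _ _ 2) => n; first exact: sumr_ge0.
apply: le_trans (sum_half n); apply: ler_sum => k _.
by rewrite sum_coef expr2_le1// leq_addr.
Qed.

Lemma width_lt_degree n k : (k < N n)%N -> (k < degree K n)%N.
Proof. by move=> kN; exact: leq_trans kN (width_le_degree K n). Qed.

(** The two exponents add up to the degree, and the degree determines the scale. *)
Lemma freq_inj n k m l : (k < N n)%N -> (l < N m)%N -> freq n k = freq m l ->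
  n = m /\ k = l.
Proof.
move=> /width_lt_degree kd /width_lt_degree ld [e kl]; split => //; apply: (degree_inj K0).
by rewrite -(subnK (ltnW kd)) -(subnK (ltnW ld)) e kl.
Qed.

Lemma fourier_freq n k : (k < N n)%N -> fourier testf (freq n k) = ((coef n k)%:C)%C.
Proof.
move=> kN; rewrite (fourier_tseries freq coef_cvg); congr (_%:C)%C.
rewrite (lim_series_single (n := n)); last first.
  move=> m mn; rewrite /tcoef big1// => l /eqP e.
  by have [e' _] := freq_inj (ltn_ord l) kN e; rewrite e' eqxx in mn.
rewrite /tcoef (bigD1 (Ordinal kN))//= big1 ?addr0// => l /andP[/eqP e].
have [_ lk] := freq_inj (ltn_ord l) kN e.
by move=> /eqP; case; exact: val_inj.
Qed.

Lemma fourier_freq_neq0 j : fourier testf j != 0 ->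
  exists n k, (k < N n)%N /\ j = freq n k.
Proof.
move=> h; apply: contrapT => H; move: h.
rewrite (fourier_tseries freq coef_cvg) (lim_series_single (n := 0%N)).
  by rewrite /tcoef big1 ?eqxx// => k /eqP e; case: H; exists 0%N, k.
by move=> m _; rewrite /tcoef big1// => k /eqP e; case: H; exists m, k.
Qed.

Lemma testf_analytic j : Order.min j.1 j.2 < 0 -> fourier testf j = 0.
Proof.
apply: contraTeq => /fourier_freq_neq0 [n [k [_ ->]]] /=.
by rewrite -leNgt le_min.
Qed.

Definition freqs M := [seq freq n k | n <- iota 0 M, k <- iota 0 (N n)].

Lemma mem_freqs M n k : (n < M)%N -> (k < N n)%N -> freq n k \in freqs M.
Proof.
by move=> nM kN; apply/allpairsPdep; exists n, k; rewrite !mem_iota.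
Qed.

Lemma freqs_uniq M : uniq (freqs M).
Proof.
apply: allpairs_uniq_dep => [|n _|]; rewrite ?iota_uniq//.
move=> _ _ /allpairsPdep[n [k [_ kN ->]]] /allpairsPdep[m [l [_ lN ->]]] /=.
rewrite !mem_iota /= !add0n in kN lN.
by move=> /(freq_inj kN lN)[-> ->].
Qed.

Lemma sum_freqs (V : nmodType) M (G : int * int -> V) :
  \sum_(j <- freqs M) G j = \sum_(0 <= n < M) \sum_(k < N n) G (freq n k).
Proof.
rewrite /freqs big_allpairs_dep /= /index_iota subn0; apply: eq_bigr => n _.
by rewrite -(big_mkord xpredT (fun k => G (freq n k))) /index_iota subn0.
Qed.

Lemma fourier_testf_le : exists B : R, forall F : {fset int * int},
  \sum_(j <- F) normc (fourier testf j) <= B.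
Proof.
exists 2 => F.
(* A frequency of scale [n] has coordinate sum [degree n > n]; hence the elements of [F] with
   nonzero coefficient all come from scales below [M]. *)
pose M := (\sum_(j <- F) (`|j.1| + `|j.2|)%N).+1.
apply: (@le_trans _ _ (\sum_(j <- freqs M) normc (fourier testf j))); last first.
  rewrite sum_freqs; apply: le_trans (sum_half M); apply: ler_sum => n _.
  rewrite (eq_bigr (fun k : 'I_(N n) => `|coef n k|)); last first.
    by move=> k _; rewrite fourier_freq// normc_R.
  by rewrite sum_coef expr2_le1// leq_addr.
have n0 (G : {fset int * int}) :
    \sum_(j <- G) normc (fourier testf j) = 
    \sum_(j <- G | fourier testf j != 0) normc (fourier testf j).
  rewrite [RHS]big_mkcond; apply: eq_bigr => j _.
  by case: eqVneq => // ->; rewrite normc0.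
rewrite n0 -big_filter; set s := [seq _ <- _ | _].
have us : uniq s by rewrite filter_uniq.
have sr : {subset s <= freqs M}.
  move=> j; rewrite mem_filter => /andP[/fourier_freq_neq0[n [k [kN je]]] jF].
  rewrite je; apply: mem_freqs => //.
  rewrite ltnS (leq_trans (ltnW (lt_degree K0 n)))//.
  rewrite (big_rem j)//= je /= subnK ?leq_addr//.
  exact/ltnW/width_lt_degree.
apply: (ler_sum_subset _ us sr) => j; exact: normc_ge0.
Qed.

End TestFunction.

Section Besov.
Local Open Scope classical_set_scope.
Local Open Scope ring_scope.
Context {R : realType}.
Variable K : nat.
Hypothesis K0 : (0 < K)%N.
Variables (w : R -> R) (hw : besov_cutoff w).
Local Notation b := (bexp K).
Local Notation N := (width K).
Local Notation L := (level K).
Local Notation e := (freq K).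
Local Notation gamma := (@amp R K).
Local Notation c := (@coef R K).
Local Notation f := (@testf R K).

(** The Euclidean norm lies between the first coordinate, which exceeds [L] because [k < N], and the
    sum [L + N] of both coordinates. *)
Lemma lattice_norm_freq n k : (k < N n)%N ->
  (L n)%:R < lattice_norm R (e n k) <= (L n)%:R + (N n)%:R.
Proof.
move=> kN; rewrite /lattice_norm /= -!pmulrn.
have Lk : (L n < degree K n - k)%N by rewrite /degree; lia.
have dk : ((degree K n - k)%:R + k%:R : R) = (L n)%:R + (N n)%:R.
  by rewrite -!natrD subnK// ltnW// width_lt_degree.
set u : R := (degree K n - k)%:R in dk *.
have Lu : (L n)%:R < u by rewrite ltr_nat.
have k0 : (0 : R) <= k%:R by [].
have L0 : (0 : R) <= (L n)%:R by [].
apply/andP; split.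
  apply: (lt_le_trans Lu); rewrite -[leLHS]ger0_norm; last by rewrite /u.
  by rewrite -sqrtr_sqr ler_wsqrtr// lerDl sqr_ge0.
rewrite -dk -[leRHS]ger0_norm; last by rewrite addr_ge0// /u.
rewrite -sqrtr_sqr ler_wsqrtr// sqrrD lerD2r lerDl mulrn_wge0// mulr_ge0//.
Qed.

Definition block m n : torus_fun R := fun z1 z2 =>
  \sum_(k < N n) (What w m (e n k))%:C%C * (c n k)%:C%C * tmono (e n k) z1 z2.

(** The norms lie strictly between [L = 2^(8 b)] and [2 L], so only two of the dyadic windows
    [[2^(m - 1), 2^(m + 1)]] can meet them. Strictness on the left is what rules out
    [m = 8 b - 1]. *)
Lemma What_freq_neq0 m n k : (k < N n)%N -> What w m (e n k) != 0 ->
  m = (8 * b n)%N \/ m = (8 * b n).+1.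
Proof.
move=> kN; have /andP[h1 h2] := lattice_norm_freq kN.
have L1 : (1 : R) <= (L n)%:R by rewrite ler1n expn_gt0.
case: m => [|m] /=.
  by rewrite leNgt (le_lt_trans L1 h1) eqxx.
move=> /(cutoff_support hw) /andP[u1 u2].
have p0 : (0 : R) < 2 ^+ m.+1 by rewrite exprn_gt0.
have b0 : (0 < b n)%N by rewrite (leq_ltn_trans (leq0n n)) ?lt_bexp.
have NL : (N n < L n)%N by rewrite ltn_exp2l//; lia.
rewrite ler_pdivrMr// -exprS in u2.
have l1 : (8 * b n < m.+2)%N.
  have := lt_le_trans h1 u2; rewrite -natrX ltr_nat /level ltn_exp2l//.
have l2 : (m < (8 * b n).+1)%N.
  rewrite ler_pdivlMr// exprS mulKf// in u1.
  have : (2 ^ m <= L n + N n)%N by rewrite -(ler_nat R) natrX natrD (le_trans u1).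
  rewrite -(@ltn_exp2l 2)// expnS -/(L n) mul2n -addnn; lia.
lia.
Qed.

(** By homogeneity the block is, up to the unimodular factor [z1^degree], a polynomial in the single
    variable [z2 / z1], to which the one-variable bound applies. *)
Lemma tblock_flat n z1 z2 : normc (tblock N c e n z1 z2) <= gamma n * (2 * 2 ^+ b n).
Proof.
pose u := val z2 / val z1.
have u1 : normc u = 1 by rewrite normcM normcV !normc_circle invr1 mulr1.
rewrite (_ : tblock _ _ _ _ _ _ = (gamma n)%:C%C * val z1 ^+ degree K n *
    \sum_(k < N n) ((rudin_shapiro (2 * b n)).1 k)%:C%C * u ^+ k).
  rewrite normcM normcM normc_R gtr0_norm ?amp_gt0//.
  have -> : normc (val z1 ^+ degree K n) = 1 by exact: (normc_exprz z1 (Posz _)).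
  by rewrite mulr1 ler_pM2l ?amp_gt0// rudin_shapiro_flat.
rewrite /tblock mulr_sumr; apply: eq_bigr => k _.
have kd := ltnW (width_lt_degree (ltn_ord k)).
have -> : tmono (e n k) z1 z2 = val z1 ^+ degree K n * u ^+ k.
  rewrite -[LHS]/(val z1 ^+ (degree K n - k) * val z2 ^+ k).
  rewrite /u expr_div_n -[in RHS](subnK kd) exprD -mulrA [X in _ = _ * X]mulrCA.
  by rewrite divff ?mulr1// expf_neq0// circle_neq0.
by rewrite /coef rmorphM /= mulrACA.
Qed.

Lemma WhatE m j : (0 < m)%N -> What w m j = w (lattice_norm R j / 2 ^+ m).
Proof. by case: m. Qed.

Lemma block_eq0 m n z1 z2 : m <> (8 * b n)%N -> m <> (8 * b n).+1 -> block m n z1 z2 = 0.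
Proof.
move=> m1 m2; rewrite /block big1// => k _.
have [->|/(What_freq_neq0 (ltn_ord k))[]//] := eqVneq (What w m (e n k)) 0.
by rewrite !mul0r.
Qed.

(* The frequencies of a block differ from [L] by at most [O(N)] and [w] is
   Lipschitz, so the cutoff is constant on the block up to [O(N / L)]; the
   constant part is controlled by the Rudin-Shapiro bound. *)
Lemma block_bound : exists2 C : R, 0 <= C & forall m n z1 z2,
  2 ^+ m * normc (block m n z1 z2) <= C * 2 ^- n.
Proof.
have [C1 C10 hC1] := cutoff_bounded hw; have [C2 C20 hC2] := cutoff_lipschitz hw.
have w_ge0 t : 0 <= w t by case: hw.
(* In [4 * C1], one factor 2 comes from the larger scale [2^m = 2 L], the other from the flatness
   bound [2 * 2^b]; the rest cancels against [gamma n]. The term [C2] results from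
   [N^2 * gamma n <= 2^-n]. *)
exists (4 * C1 + C2); first by rewrite addr_ge0// mulr_ge0.
move=> m n z1 z2.
have b0 : (0 < b n)%N by rewrite (leq_ltn_trans (leq0n n)) ?lt_bexp.
have [mm|mm] := boolP ((m == 8 * b n)%N || (m == (8 * b n).+1)); last first.
  move/norP: mm => [/eqP m1 /eqP m2]; rewrite block_eq0// normc0 mulr0.
  by rewrite mulr_ge0 ?invr_ge0 ?exprn_ge0// addr_ge0// mulr_ge0.
have lm : (8 * b n <= m <= (8 * b n).+1)%N.
  by case/orP: mm => /eqP ->; rewrite ?leqnn ?leqnSn.
have m0 : (0 < m)%N by lia.
have p0 : (0 : R) < 2 ^+ m by rewrite exprn_gt0.
pose w0 := w ((L n)%:R / 2 ^+ m).
have -> : block m n z1 z2 = w0%:C%C * tblock N c e n z1 z2 + \sum_(k < N n)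
    (What w m (e n k) - w0)%:C%C * (c n k)%:C%C * tmono (e n k) z1 z2.
  rewrite /tblock mulr_sumr -big_split /=; apply: eq_bigr => k _.
  by rewrite rmorphB /= !mulrBl -!mulrA addrC subrK.
have h1 : 2 ^+ m * normc (w0%:C%C * tblock N c e n z1 z2) <= 4 * C1 * 2 ^- n.
  rewrite normcM normc_R (ger0_norm (w_ge0 _)).
  have h : w0 * normc (tblock N c e n z1 z2) <= C1 * (gamma n * (2 * 2 ^+ b n)).
    by apply: ler_pM; [exact: w_ge0|exact: normc_ge0|exact: hC1|exact: tblock_flat].
  apply: (le_trans (ler_wpM2l (ltW p0) h)).
  have -> : 4 * C1 * 2 ^- n = C1 * (2 ^+ (8 * b n).+1 * (gamma n * (2 * 2 ^+ b n))).
    rewrite /amp (_ : (n + 9 * b n = 8 * b n + (b n + n))%N); last by lia.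
    have pw k : (2 : R) ^+ k != 0 by rewrite expf_neq0.
    rewrite (exprD _ (8 * b n)) (exprD _ (b n)) exprS; move: (pw (8 * b n)%N) (pw (b n)) (pw n).
    move: (2 ^+ (8 * b n)) (2 ^+ b n) (2 ^+ n) => x y z x0 y0 z0.
    by field; rewrite x0 y0 z0.
  rewrite mulrCA; apply: ler_wpM2l => //; apply: ler_wpM2r.
    by rewrite mulr_ge0 ?(ltW (amp_gt0 _ _))// mulr_ge0// exprn_ge0.
  by rewrite ler_eXn2l ?ltr1n//; case/andP: lm.
have h2 k : (k < N n)%N -> `|What w m (e n k) - w0| <= C2 * ((N n)%:R / 2 ^+ m).
  move=> kN; have /andP[l1 l2] := lattice_norm_freq kN.
  have NL : (N n <= L n)%N by rewrite leq_exp2l//; lia.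
  have Lm : (L n)%:R <= 2 ^+ m :> R.
    by rewrite /level natrX ler_eXn2l ?ltr1n//; case/andP: lm.
  have NLR : (N n)%:R <= (L n)%:R :> R by rewrite ler_nat.
  have L0 : (0 : R) <= (L n)%:R by [].
  rewrite WhatE//; apply: (le_trans (hC2 _ _ _ _)).
  - apply/andP; split; first by rewrite divr_ge0 ?(ltW p0)// (le_trans L0) ?ltW.
    rewrite ler_pdivrMr//; lra.
  - apply/andP; split; first by rewrite divr_ge0 ?(ltW p0).
    rewrite ler_pdivrMr//; lra.
  rewrite ler_wpM2l// -mulrBl normrM (gtr0_norm (x := _^-1)) ?invr_gt0//.
  rewrite ler_wpM2r ?invr_ge0 ?(ltW p0)// ger0_norm; lra.
set S := \sum_(k < _) _.
have h3 : normc S <= (N n)%:R * (C2 * ((N n)%:R / 2 ^+ m) * gamma n).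
  apply: (@le_trans _ _ (\sum_(k < N n) (C2 * ((N n)%:R / 2 ^+ m) * gamma n))); last first.
    by rewrite sumr_const card_ord [leRHS]mulr_natl.
  apply: (le_trans (normc_sum_le _ _)); apply: ler_sum => k _.
  rewrite normcM normc_tmono mulr1 normcM !normc_R norm_coef.
  by rewrite ler_wpM2r ?(ltW (amp_gt0 _ _))// h2.
have h4 : 2 ^+ m * normc S <= C2 * 2 ^- n.
  apply: (le_trans (ler_wpM2l (ltW p0) h3)).
  have -> : 2 ^+ m * ((N n)%:R * (C2 * ((N n)%:R / 2 ^+ m) * gamma n)) =
      C2 * ((N n)%:R ^+ 2 * gamma n).
    move: (2 ^+ m) p0 => x x0; move: (N n)%:R (gamma n) => y z.
    by field; rewrite gt_eqF.
  apply: ler_wpM2l => //.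
  rewrite /amp /width natrX -exprM (_ : (n + 9 * b n = 2 * b n * 2 + (n + 5 * b n))%N); last by lia.
  by rewrite exprD invfM mulrA divff ?mul1r ?expf_neq0// expr2_le1// leq_addr.
rewrite mulrDl; apply: le_trans (lerD h1 h4); rewrite -mulrDr.
by rewrite ler_wpM2l ?(ltW p0)// le_normcD.
Qed.

(** Scale [n] meets the piece [m] only if [m >= 8 * b n], which exceeds [n]; the scales up to [m]
    therefore account for the whole piece. *)
Lemma besov_piece_testf m z1 z2 :
  besov_piece w f m z1 z2 = \sum_(0 <= n < m.+1) block m n z1 z2.
Proof.
rewrite /besov_piece (fsbigE (freqs K m.+1)) //; last first.
- move=> j _ jr; have [->|j0] := eqVneq (fourier f j) 0; first by rewrite mulr0 mul0r.
  have [n [k [kN je]]] := fourier_freq_neq0 K0 j0.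
  have [->|] := eqVneq (What w m j) 0; first by rewrite !mul0r.
  rewrite je => /(What_freq_neq0 kN) mm; exfalso; move/negP: jr; apply.
  rewrite je; apply: mem_freqs => //; have := lt_bexp K0 n; lia.
- exact: freqs_uniq.
rewrite (eq_bigl xpredT) => [|j]; last by rewrite in_setT.
rewrite sum_freqs; apply: eq_bigr => n _; rewrite /block; apply: eq_bigr => k _.
by rewrite fourier_freq.
Qed.

Lemma testf_besov_norm : (besov_norm w f < +oo)%E.
Proof.
have [C C0 hC] := block_bound.
(* Each [n] is met by two values of [m] only. Summing over [m] first gives [2 * C * 2^-n], and then
   [4 * C] in total. *)
pose hit m n : R := C * 2 ^- n *+ ((m == 8 * b n)%N || (m == (8 * b n).+1)).
have hit_ge0 m n : 0 <= hit m n.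
  by rewrite mulrn_wge0// mulr_ge0// invr_ge0 exprn_ge0.
have piece m : ((2 ^+ m)%:E * torus_sup (besov_piece w f m) <=
    (\sum_(0 <= n < m.+1) hit m n)%:E)%E.
  have p0 : (0 : R) < 2 ^+ m by rewrite exprn_gt0.
  rewrite muleC -lee_pdivlMr//; apply: ge_ereal_sup => _ [[z1 z2] _ <-] /=.
  rewrite -EFinM lee_fin ler_pdivlMr// besov_piece_testf mulrC.
  apply: (le_trans (ler_wpM2l (ltW p0) (normc_sum_le _ _))).
  rewrite mulr_sumr; apply: ler_sum => n _; rewrite /hit.
  have [_|/norP[/eqP m1 /eqP m2]] := boolP (_ || _); first by rewrite mulr1n hC.
  by rewrite block_eq0// normc0 mulr0.
apply: (@le_lt_trans _ _ (4 * C)%:E); last exact: ltry.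
apply: lime_le.
  apply: is_cvg_nneseries => m _ _; apply: mule_ge0.
    by rewrite lee_fin exprn_ge0.
  apply: (@le_trans _ _ (complex.Re `|besov_piece w f m (expi 0) (expi 0)|)%:E).
    by rewrite lee_fin; exact: normc_ge0.
  by apply: ereal_sup_ubound; exists (expi 0, expi 0).
apply: nearW => M.
apply: (@le_trans _ _ (\sum_(0 <= m < M) (\sum_(0 <= n < M) hit m n)%:E)%E).
  rewrite !big_nat; apply: lee_sum => m /andP[_ mM].
  apply: (le_trans (piece m)); rewrite lee_fin.
  by rewrite [leRHS](big_cat_nat (n := m.+1))//= lerDl sumr_ge0.
rewrite sumEFin lee_fin exchange_big /=.
apply: (@le_trans _ _ (\sum_(0 <= n < M) C * 2 ^- n * 2)).
  apply: ler_sum => n _.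
  have x0 : 0 <= C * 2 ^- n by rewrite mulr_ge0// invr_ge0 exprn_ge0.
  apply: (@le_trans _ _ (\sum_(0 <= m < M) (C * 2 ^- n *+ (m == 8 * b n)%N +
      C * 2 ^- n *+ (m == (8 * b n).+1)))).
    apply: ler_sum => m _; rewrite /hit.
    by do 2 case: eqP => _ /=; rewrite ?mulr1n ?mulr0n ?addr0 ?add0r// lerDl.
  by rewrite big_split /= mulr_natr mulr2n lerD// sum_eq_le.
rewrite -mulr_suml -mulr_sumr.
have hs : \sum_(0 <= n < M) 2 ^- n <= 2 :> R by exact: sum_half.
have : C * (\sum_(0 <= n < M) 2 ^- n) <= C * 2 by rewrite ler_wpM2l.
lra.
Qed.

End Besov.

(** * The unitary operators *)

Lemma hnorm_delta_le1 (R : realType) (S : nat -> finType) (i : {n : nat & S n}) :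
  hnorm (delta R i : hl2 R S) <= 1.
Proof.
rewrite -(@ler_pXn2r _ 2) ?nnegrE ?hnorm_ge0//.
apply: le_trans (hnorm_single (n := tag i) _) _ => [m mi|].
  by rewrite bsq_delta eq_sym (negbTE mi).
by rewrite bsq_delta eqxx expr1n.
Qed.

Section Operators.
Local Open Scope classical_set_scope.
Local Open Scope ring_scope.
Context {R : realType}.
Local Notation C := R[i].
Variable K : nat.
Hypothesis K0 : (0 < K)%N.
Variable r : nat -> nat.
Local Notation b := (bexp K).
Local Notation N := (width K).
Local Notation L := (level K).
Local Notation d := (degree K).
Local Notation e := (freq K).
Local Notation f := (@testf R K).

Definition cell n : finType := ('I_(r n) * 'I_(2 * N n))%type.
Local Notation H := (hl2 R cell).
Local Notation I := {n : nat & cell n}.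

Definition succ_cell n (t : cell n) : cell n := (t.1, ordS t.2).
Definition pred_cell n (t : cell n) : cell n := (t.1, ord_pred t.2).

Lemma pred_cellK n : cancel (@pred_cell n) (@succ_cell n).
Proof. by case=> c t; rewrite /succ_cell /pred_cell /= ord_predK. Qed.

Lemma succ_cellK n : cancel (@succ_cell n) (@pred_cell n).
Proof. by case=> c t; rewrite /succ_cell /pred_cell /= ordSK. Qed.

(** The signs occupy the first half of the cycle. The target position [N n] is the first one outside
    it, so that the end of a path contributes the factor 1. *)
Definition sign n (t : cell n) : R :=
  if (t.2 < N n)%N then (rudin_shapiro (2 * b n)).1 t.2 else 1.

Lemma sign_sqr n (t : cell n) : sign t * sign t = 1.
Proof.
rewrite /sign; case: ifP => _; last by rewrite mulr1.
by rewrite -expr2; case: (@rudin_shapiro_sqr R (2 * b n) (nat_of_ord t.2)).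
Qed.

Lemma norm_sign n (t : cell n) : `|sign t| = 1.
Proof. by apply/eqP; rewrite -(@eqrXn2 _ 2)// real_normK ?num_real// expr2 sign_sqr expr1n. Qed.

Lemma normc_one (i : I) : normc ((fun=> 1 : C) i) = 1.
Proof. exact: normc1. Qed.

Definition opV : unitary H := wunitary normc_one pred_cellK succ_cellK.

(* [zeta * twist] is the weight of the shift [zeta D V D] for [D = diag sign]. *)
Definition twist (i : I) : R := sign (tagged i) * sign (pred_cell (tagged i)).

Section Rotation.
Variable zeta : nat -> C.
Hypothesis zeta1 : forall n, normc (zeta n) = 1.

Definition weightU (i : I) : C := zeta (tag i) * (twist i)%:C%C.

Lemma normc_weightU i : normc (weightU i) = 1.
Proof. by rewrite normcM zeta1 normc_R normrM !norm_sign !mulr1. Qed.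

Definition opU : unitary H := wunitary normc_weightU pred_cellK succ_cellK.

Lemma width2_gt0 n : (0 < 2 * N n)%N.
Proof. by rewrite muln_gt0 /= expn_gt0. Qed.

Definition cyc n k : 'I_(2 * N n) := Ordinal (ltn_pmod k (width2_gt0 n)).

Lemma ordS_cyc n k : ordS (cyc n k) = cyc n k.+1.
Proof. by apply: val_inj; rewrite /= -addn1 modnDml addn1. Qed.

Definition bvec n (c : 'I_(r n)) k : H := delta R (idx (T := cell) (c, cyc n k)).

Lemma opV_bvec n (c : 'I_(r n)) k : opV (bvec c k) = bvec c k.+1.
Proof. by rewrite /opV /bvec wunitary_delta scale1r /succ_cell /= ordS_cyc. Qed.

Lemma opU_bvec n (c : 'I_(r n)) k : opU (bvec c k) =
  (zeta n * (sign (n := n) (c, cyc n k) * sign (n := n) (c, cyc n k.+1))%:C%C)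
    *: bvec c k.+1.
Proof.
rewrite /opU /bvec wunitary_delta /succ_cell /= ordS_cyc; congr (_ *: _).
rewrite /weightU /twist /= /pred_cell /= -ordS_cyc ordSK mulrC.
by rewrite mulrC [X in (X)%:C%C]mulrC.
Qed.

Lemma upow_opV n (c : 'I_(r n)) k : upow opV (Posz k) (bvec c 0) = bvec c k.
Proof. by elim: k => //= k ->; rewrite opV_bvec. Qed.

(** The shift is conjugated by a diagonal of signs, so the signs at intermediate positions cancel
    and only those at the two ends survive. *)
Lemma upow_opU n (c : 'I_(r n)) k j : upow opU (Posz j) (bvec c k) =
  (zeta n ^+ j * (sign (n := n) (c, cyc n k) * sign (n := n) (c, cyc n (k + j)))%:C%C)
    *: bvec c (k + j).
Proof.
elim: j => [|j IH]; first by rewrite /= addn0 sign_sqr expr0 mulr1 scale1r.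
rewrite [LHS]/= -[iter j opU _]/(upow opU (Posz j) (bvec c k)) IH linearZ /= opU_bvec.
rewrite scalerA addnS; congr (_ *: _).
have y2 := sign_sqr (n := n) (c, cyc n (k + j)).
set x := sign (c, cyc n k); set y := sign _ in y2 *; set z := sign _.
have -> : (x * z)%:C%C = (x * y)%:C%C * (y * z)%:C%C.
  by rewrite -rmorphM /=; congr (_%:C)%C; rewrite mulrA -(mulrA x) y2 mulr1.
by rewrite exprSr mulrACA.
Qed.

Lemma bvec_coord n (c c' : 'I_(r n)) k l :
  (bvec c k : l2 R cell) (idx (T := cell) (c', cyc n l)) =
  ((c == c') && (cyc n k == cyc n l))%:R.
Proof. by rewrite /bvec /= -tag_eqE /tag_eq /= eqxx /= tagged_asE. Qed.

Definition fterm n (c : 'I_(r n)) (j : int * int) : H :=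
  fourier f j *: upow opU j.1 (upow opV j.2 (bvec c 0)).

Definition target_idx n (c : 'I_(r n)) : I := idx (T := cell) (c, cyc n (N n)).

Lemma term_freq n (c : 'I_(r n)) m k : (k < N m)%N -> fterm c (e m k) =
  (@coef R K m k)%:C%C *: ((zeta n ^+ (d m - k) *
    (sign (n := n) (c, cyc n k) * sign (n := n) (c, cyc n (d m)))%:C%C) *: bvec c (d m)).
Proof.
move=> kN; rewrite /fterm fourier_freq//; congr (_ *: _).
rewrite -[LHS]/(upow opU (Posz (d m - k)) (upow opV (Posz k) (bvec c 0))).
by rewrite upow_opV upow_opU subnKC// ltnW// width_lt_degree.
Qed.

(** A term of scale [m] ends at position [degree m] of the cycle, whatever its [k], and [degree_mod]
    excludes the target unless [m = n]. *)
Lemma term_eq0 n (c c' : 'I_(r n)) j : j \notin [seq e n k | k <- iota 0 (N n)] ->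
  (fterm c j : l2 R cell) (target_idx c') = 0.
Proof.
move=> jn; have [j0|/(fourier_freq_neq0 K0)[m [k [kN je]]]] := eqVneq (fourier f j) 0.
  by rewrite /fterm j0 scale0r.
rewrite je term_freq// !l2Z bvec_coord.
have -> : (cyc n (d m) == cyc n (N n)) = false; last by rewrite andbF !mulr0.
rewrite -val_eqE /= [X in _ == X]modn_small; last by rewrite ltn_Pmull// expn_gt0.
rewrite degree_mod//; apply/negbTE; apply: contraNneq jn => mn.
by rewrite je mn map_f// mem_iota /= -mn.
Qed.

(** [V^k] leads to position [k], where the path picks up the sign of the [k]-th coefficient itself.
    The two signs multiply to 1, so the terms no longer differ in sign and can add up. *)
Lemma term_coord n (c c' : 'I_(r n)) k : (k < N n)%N ->
  (fterm c (e n k) : l2 R cell) (target_idx c') =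
  (c == c')%:R * ((@amp R K n)%:C%C * zeta n ^+ (d n - k)).
Proof.
move=> kN; rewrite term_freq// !l2Z bvec_coord.
have NQ : (N n < 2 * N n)%N by rewrite ltn_Pmull// expn_gt0.
have -> : cyc n (d n) = cyc n (N n).
  by apply/val_inj => /=; rewrite [RHS]modn_small//; apply/eqP; rewrite degree_mod.
rewrite eqxx andbT /sign /= !modn_small// ?ltnn ?kN; last exact: ltn_trans NQ.
have [h _] := @rudin_shapiro_sqr R (2 * b n) k.
rewrite mulr1 /coef.
have -> : (@amp R K n * (rudin_shapiro (2 * b n)).1 k)%:C%C = 
   (@amp R K n)%:C%C * ((rudin_shapiro (2 * b n)).1 k)%:C%C :> C by rewrite rmorphM.
set x := (rudin_shapiro _).1 k in h *; set y := zeta n ^+ _; set a := (@amp R K n)%:C%C.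
have x2 : (x%:C%C * x%:C%C : C) = 1 by rewrite -rmorphM /= -expr2 h.
by rewrite mulrA mulrC; congr (_ * _); rewrite -mulrA (mulrCA _ y) x2 mulr1.
Qed.

Lemma fun_partial_coord n (c c' : 'I_(r n)) (F : {fset int * int}) :
  {subset [seq e n k | k <- iota 0 (N n)] <= F} ->
  (fun_partial f opU opV F (bvec c 0) : l2 R cell) (target_idx c') =
  (c == c')%:R * ((@amp R K n)%:C%C * \sum_(k < N n) zeta n ^+ (d n - k)).
Proof.
move=> sF; rewrite /fun_partial l2_sum.
have us : uniq [seq e n k | k <- iota 0 (N n)].
  by rewrite map_inj_uniq ?iota_uniq// => k l [].
rewrite (bigID (mem [seq e n k | k <- iota 0 (N n)])) /= addrC big1 ?add0r; last first.
  by move=> j jn; exact: term_eq0.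
rewrite -big_filter (perm_big [seq e n k | k <- iota 0 (N n)]) /=; last first.
  apply: uniq_perm => //; first exact/filter_uniq/fset_uniq.
  by move=> j; rewrite mem_filter; apply: andb_idr => /sF.
rewrite big_map -(big_mkord xpredT (fun k => zeta n ^+ (d n - k))) /index_iota subn0.
rewrite !mulr_sumr !big_seq; apply: eq_bigr => k; rewrite mem_iota => /andP[_ kN].
exact: term_coord.
Qed.

End Rotation.
End Operators.

(** * The perturbation and the displacement that it causes *)

Section Counterexample.
Local Open Scope classical_set_scope.
Local Open Scope ring_scope.
Context {R : realType}.
Local Notation C := R[i].
Variable K : nat.
Hypothesis K0 : (0 < K)%N.
Local Notation b := (bexp K).
Local Notation N := (width K).
Local Notation L := (level K).
Local Notation d := (degree K).
Local Notation f := (@testf R K).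
Local Notation gamma := (@amp R K).

Definition angle n : R := pi / (L n)%:R.

Definition zeta n : C := val (expi (angle n)).

Lemma normc_zeta n : normc (zeta n) = 1.
Proof. exact: normc_circle. Qed.

Lemma L_gt0 n : (0 : R) < (L n)%:R.
Proof. by rewrite ltr0n expn_gt0. Qed.

Lemma angle_gt0 n : 0 < angle n.
Proof. by rewrite divr_gt0 ?pi_gt0 ?L_gt0. Qed.

Lemma normc_1Bzeta n : normc (1 - zeta n) <= angle n.
Proof.
rewrite -(@ler_pXn2r _ 2) ?nnegrE ?normc_ge0 ?(ltW (angle_gt0 n))//.
rewrite normc_sqr /= sub0r sqrrN.
set t := angle n; have t0 : 0 <= t / 2 by rewrite divr_ge0// ltW// angle_gt0.
(* The half angle gives [|1 - e^(i t)|^2 = 4 sin^2 (t / 2)]. *)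
rewrite (splitr t) cosD sinD.
have h1 := cos2Dsin2 (t / 2).
have h2 : sin (t / 2) ^+ 2 <= (t / 2) ^+ 2.
  rewrite -[leLHS]real_normK ?num_real// ler_pXn2r ?nnegrE//; exact: norm_sin_le.
move: (t / 2) h1 h2 => z; move: (cos z) (sin z) => x y h1 h2.
have -> : (1 - (x * x - y * y)) ^+ 2 + (y * x + x * y) ^+ 2 = 4 * y ^+ 2.
  have -> : x * x = 1 - y ^+ 2 by rewrite -h1; ring.
  have -> : (y * x + x * y) ^+ 2 = 4 * y ^+ 2 * x ^+ 2 by ring.
  by have -> : x ^+ 2 = 1 - y ^+ 2 by [rewrite -h1; ring]; ring.
have -> : (z + z) ^+ 2 = 4 * z ^+ 2 by ring.
lra.
Qed.

(** Since [L * angle = pi], the argument of the power is [pi] plus [(N - k) pi / L]. The second part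
    is at most [pi / 2] because [2 N <= L], so the power has nonpositive real part. Bounding real
    parts, rather than moduli, excludes cancellation in the sum over [k]. *)
Lemma Re_1Bzeta n k : (k < N n)%N -> 1 <= complex.Re (1 - zeta n ^+ (d n - k)).
Proof.
move=> kN; rewrite expi_exprn /=.
have NL : (2 * N n <= L n)%N.
  by rewrite -expnS leq_exp2l//; have := lt_bexp K0 n; lia.
pose x : R := (N n - k)%:R * angle n.
have -> : (d n - k)%:R * angle n = pi + x.
  rewrite /x /degree -addnBA 1?ltnW// natrD mulrDl; congr (_ + _).
  by rewrite /angle mulrC divfK// gt_eqF// L_gt0.
rewrite [pi + x]addrC cosDpi opprK lerDl; apply: cos_ge0_pihalf.
have x0 : 0 <= x by rewrite mulr_ge0// ltW// angle_gt0.
apply/andP; split; first by apply: le_trans x0; rewrite oppr_le0 divr_ge0// pi_ge0.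
apply: (@le_trans _ _ ((N n)%:R * angle n)).
  by apply: ler_wpM2r; [exact/ltW/angle_gt0|rewrite ler_nat leq_subr].
rewrite /angle mulrCA ler_pM2l ?pi_gt0// ler_pdivrMr ?L_gt0//.
by rewrite mulrC ler_pdivlMr// -natrM ler_nat mulnC.
Qed.

Variable r : nat -> nat.
Local Notation cell := (cell K r).
Local Notation H := (hl2 R cell).

Local Notation opV' := (@opV R K r).

Definition opU1 : unitary H := opU K r (zeta := fun=> 1) (fun=> normc1 R).
Definition opU2 : unitary H := opU K r normc_zeta.

Definition gap n : C := (gamma n)%:C%C * \sum_(k < N n) (1 - zeta n ^+ (d n - k)).

Lemma gap_ge n : gamma n * (N n)%:R <= normc (gap n).
Proof.
rewrite normcM normc_R gtr0_norm ?amp_gt0// ler_pM2l ?amp_gt0//.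
apply: le_trans (le_trans (ler_norm _) (ler_Re_normc _)).
rewrite Re_sum -[leLHS]mulr_natl -[X in X%:R * _]card_ord mulr_natl -sumr_const.
by apply: ler_sum => k _; exact: Re_1Bzeta.
Qed.

(** Operator norm convergence controls each coordinate, and the partial sums already have their
    final value at the target once they contain the frequencies of scale [n]. The limit is therefore
    computed exactly. *)
Lemma diff_coord (A1 A2 : {linear H -> H}) n (c c' : 'I_(r n)) :
  is_fun_unitary f opU1 opV' A1 -> is_fun_unitary f opU2 opV' A2 ->
  ((A1 \- A2)%R (bvec K c 0) : l2 R cell) (target_idx K c') = (c == c')%:R * gap n.
Proof.
move=> h1 h2; apply/eqP; rewrite -subr_eq0; apply/eqP/eq0_normc/eqP.
rewrite eq_le normc_ge0 andbT; apply/ler_addgt0Pr => eps eps0; rewrite add0r.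
have eps20 : 0 < eps / 2 by rewrite divr_gt0.
have [F1 hF1] := h1 _ eps20; have [F2 hF2] := h2 _ eps20.
pose S := [fset j in [seq freq K n k | k <- iota 0 (N n)]]%fset.
pose F := (F1 `|` F2 `|` S)%fset.
have sF : {subset [seq freq K n k | k <- iota 0 (N n)] <= F}.
  by move=> j jS; rewrite !in_fsetU; apply/orP; right; rewrite inE.
have x1 := hnorm_delta_le1 R (idx (T := cell) (c, cyc K n 0)).
pose x : H := bvec K c 0.
have close (A : {linear H -> H}) (U : unitary H) :
    (opnorm (A \- fun_partial f U opV' F)%R <= (eps / 2)%:E)%E ->
    normc ((A x : l2 R cell) (target_idx K c') -
      (fun_partial f U opV' F x : l2 R cell) (target_idx K c')) <= eps / 2.
  move=> hA; pose y : H := A x - fun_partial f U opV' F x.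
  apply: (le_trans (coord_le_hnorm y (tagged (target_idx K c')))).
  rewrite -lee_fin; apply: le_trans hA; apply: ereal_sup_ubound; exists x => //.
have F1F : (F1 `<=` F)%fset by rewrite /F -fsetUA fsubsetUl.
have F2F : (F2 `<=` F)%fset by rewrite /F fsetUAC fsubsetUr.
have := close A1 opU1 (hF1 F F1F); have := close A2 opU2 (hF2 F F2F).
rewrite !fun_partial_coord//.
have -> : gap n = (gamma n)%:C%C * (\sum_(k < N n) 1 ^+ (d n - k)) -
    (gamma n)%:C%C * \sum_(k < N n) zeta n ^+ (d n - k).
  rewrite -mulrBr -sumrB; congr (_ * _); apply: eq_bigr => k _.
  by rewrite expr1n.
have -> : ((A1 \- A2)%R (bvec K c 0) : l2 R cell) (target_idx K c') =
  (A1 x : l2 R cell) (target_idx K c') - (A2 x : l2 R cell) (target_idx K c') by [].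
move: (_ (target_idx K c')) (_ (target_idx K c')) => u v.
set p := (gamma n)%:C%C * _; set q := (gamma n)%:C%C * _ => hv hu.
have -> : u - v - (c == c')%:R * (q - p) =
   (u - (c == c')%:R * q) - (v - (c == c')%:R * p) by ring.
rewrite (le_trans (le_normcD _ _))// normcN (splitr eps) lerD//.
Qed.

Lemma schatten_opnorm (T : {linear H -> H}) (w : wperm R cell) :
  (forall x, T x = wop w x) -> (opnorm T < +oo)%E.
Proof.
move=> hT; apply: (@le_lt_trans _ _ (wbound w)%:E); last exact: ltry.
apply: opnorm_le; first exact: wbound_ge0.
by move=> x; rewrite hT; apply: hnorm_wop; [exact: wbound_ge0|exact: wweight_le].
Qed.

Definition weight_diff (i : {n : nat & cell n}) : C :=
  (1 - zeta (tag i)) * (@twist R K r i)%:C%C.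

Lemma normc_weight_diff i : normc (weight_diff i) <= angle (tag i).
Proof.
by rewrite normcM normc_R normrM !norm_sign !mulr1 normc_1Bzeta.
Qed.

Lemma angle_le n m : (n <= m)%N -> angle m <= angle n.
Proof.
move=> nm; rewrite ler_pM2l ?pi_gt0// lef_pV2 ?posrE ?L_gt0// ler_nat.
by rewrite leq_exp2l// leq_pmul2l// bexp_leq.
Qed.

Lemma weight_diff_le i : normc (weight_diff i) <= angle 0.
Proof. exact: le_trans (normc_weight_diff i) (angle_le (leq0n _)). Qed.

Definition wdiff : wperm R cell :=
  WPerm (ltW (angle_gt0 0)) weight_diff_le (fun n => can_inj (@pred_cellK K r n)).

Lemma diff_wdiff x : (opU1 \- opU2)%R x = wop wdiff x.
Proof.
apply: l2_ext => n t; rewrite wopE.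
have -> : ((opU1 \- opU2)%R x : l2 R cell) (idx t) =
  (opU1 x : l2 R cell) (idx t) - (opU2 x : l2 R cell) (idx t) by [].
rewrite !wunitaryE -mulrBl; congr (_ * _).
by rewrite /weightU /= /weight_diff mulrBl.
Qed.

Lemma schatten_diff (p M : R) : 0 <= p -> (forall n, (0 < r n)%N) ->
  (forall n, \sum_(m < n) (r m * (2 * N m))%:R * (angle m `^ p) <= M) ->
  schatten p (opU1 \- opU2).
Proof.
move=> p0 r0 hM; split; first exact: schatten_opnorm diff_wdiff.
have cardT n : #|cell n| = (r n * (2 * N n))%N by rewrite card_prod !card_ord.
(* Total dimension of the blocks before [n]; once these are removed, the weights of the difference
   are at most [angle n]. *)
pose B n := (\sum_(m < n) #|cell m|)%N.
have BS n : B n.+1 = (B n + #|cell n|)%N by rewrite /B big_ord_recr.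
apply: (@schatten_sum_lt _ _ p B angle _ M) => //.
- by rewrite /B big_ord0.
- move=> n; rewrite BS -addn1 leq_add2l cardT muln_gt0 r0 /=.
  exact: width2_gt0.
- by move=> n; exact/ltW/angle_gt0.
- move=> n k nk; apply: (singular_value_wop_le diff_wdiff) nk.
    exact/ltW/angle_gt0.
  move=> m t nm; apply: (le_trans (normc_weight_diff _)); exact: angle_le.
- move=> n; apply: le_trans (hM n); apply: ler_sum => m _.
  by rewrite BS addKn cardT.
Qed.

Lemma not_schatten_diff (p : R) (A1 A2 : {linear H -> H}) : 0 <= p ->
  (forall n, n%:R <= (r n)%:R * ((gamma n * (N n)%:R) `^ p)) ->
  is_fun_unitary f opU1 opV' A1 -> is_fun_unitary f opU2 opV' A2 ->
  ~ schatten p (A1 \- A2).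
Proof.
move=> p0 hr h1 h2 [_ hS].
pose s := fine (\sum_(0 <= n <oo) (singular_value (A1 \- A2)%R n `^ p))%E.
have sE : (\sum_(0 <= n <oo) (singular_value (A1 \- A2)%R n `^ p) = s%:E)%E.
  rewrite fineK// ge0_fin_numE// nneseries_ge0// => n _ _; exact: poweR_ge0.
(* The singular values coming from the single scale [n] already sum to at least [n], so a scale
   beyond the supposed finite sum gives the contradiction. *)
pose n := (Num.truncn s).+1.
have ns : s < n%:R by exact: truncnS_gt.
have g0 : 0 <= gamma n * (N n)%:R by rewrite mulr_ge0// ltW// amp_gt0.
have gp : 0 < gamma n * (N n)%:R by rewrite mulr_gt0 ?amp_gt0// ltr0n expn_gt0.
have hk k : (k < r n)%N -> ((gamma n * (N n)%:R)%:E <= singular_value (A1 \- A2)%R k)%E.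
  move=> kr; apply: (@le_trans _ _ (normc (gap n))%:E); first by rewrite lee_fin gap_ge.
  apply: (singular_value_ge (n := n) (r := r n) (g := fun c => (c, cyc K n 0) : cell n)
    (h := fun c => (c, cyc K n (N n)) : cell n)) => //.
  - by move=> c c' [].
  - by move=> c c' [].
  - exact: lt_le_trans (gap_ge n).
  - by move=> c c'; exact: diff_coord.
have := schatten_sum_ge p0 g0 hk; rewrite sE lee_fin => h.
have := le_lt_trans (le_trans (hr n) h) ns; by rewrite ltxx.
Qed.

End Counterexample.

(** * Number of copies of each block *)

Section Multiplicities.
Context {R : realType}.
Variables (p : R) (K : nat).
Hypothesis p2 : 2 < p.
Hypothesis K0 : (0 < K)%N.
Hypothesis Kp : p + 2 <= K%:R * (p - 2).
Local Notation b := (bexp K).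
Local Notation N := (width K).
Local Notation L := (level K).

(** Chosen so that [ratio n * (2 N) * (pi / L)^p] equals [2 pi^p 2^-n]: as many copies as the
    Schatten sum of the perturbation allows, up to a summable weight. *)
Definition ratio n : R := (L n)%:R `^ p / (2 ^+ n * (N n)%:R).

(** This rounding serves both estimates, being at least [ratio n] and at most [ratio n + 1]; it also
    makes every block occur. *)
Definition mult n := (Num.truncn (ratio n)).+1.

Lemma ratio_ge0 n : 0 <= ratio n.
Proof. by rewrite divr_ge0 ?powR_ge0 ?mulr_ge0 ?exprn_ge0. Qed.

Lemma mult_angle_le n :
  (mult n * (2 * N n))%:R * (angle K n `^ p) <= 4 * pi `^ p * 2 ^- n.
Proof.
have L0 := @L_gt0 R K n.
have N0 : (0 : R) < (N n)%:R by rewrite ltr0n expn_gt0.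
have Lp0 : 0 < (L n)%:R `^ p :> R by exact: powR_gt0.
have -> : angle K n `^ p = pi `^ p / (L n)%:R `^ p.
  apply: (mulIf (lt0r_neq0 Lp0)); rewrite divfK ?gt_eqF//.
  rewrite -powRM ?(ltW (angle_gt0 _ _))// ?ltW//.
  by rewrite /angle divfK// gt_eqF.
have e0 : (0 : R) < 2 ^+ n by rewrite exprn_gt0.
have p1 : 1 <= p by rewrite ltW// (lt_trans _ p2)// ltr1n.
have h1 : (mult n)%:R <= ratio n + 1.
  by rewrite /mult -natr1 lerD2r truncn_le ratio_ge0.
(* The extra copy due to rounding costs [2 N pi^p / L^p], which this bound reduces to
   [2 pi^p 2^-n]. *)
have NL : (N n)%:R * 2 ^+ n <= (L n)%:R `^ p :> R.
  apply: (@le_trans _ _ ((L n)%:R `^ 1)); last first.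
    by apply: ler_powR; [rewrite ler1n expn_gt0|exact: p1].
  rewrite powRr1 ?(ltW L0)// -natrX -natrM ler_nat /width /level -expnD leq_exp2l//.
  have := lt_bexp K0 n; lia.
rewrite natrM [(2 * N n)%:R]natrM.
apply: (@le_trans _ _ ((ratio n + 1) * (2 * (N n)%:R) * (pi `^ p / (L n)%:R `^ p))).
  rewrite ler_wpM2r ?divr_ge0 ?powR_ge0// ler_wpM2r// mulr_ge0//.
rewrite /ratio; move: (powR_ge0 (@pi R) p) NL Lp0 N0 e0.
move: (pi `^ p) ((L n)%:R `^ p) (N n)%:R (2 ^+ n) => x l y t x0 NL l0 y0 t0.
have -> : (l / (t * y) + 1) * (2 * y) * (x / l) = 2 * x / t + 2 * x / t * ((y * t) / l).
  by field; rewrite !gt_eqF.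
have -> : 4 * x / t = 2 * x / t + 2 * x / t * 1 by field; rewrite gt_eqF.
rewrite lerD2l ler_wpM2l ?divr_ge0 ?mulr_ge0 ?(ltW t0)//.
by rewrite ler_pdivrMr// mul1r.
Qed.

Lemma sum_mult_angle_le n :
  \sum_(m < n) (mult m * (2 * N m))%:R * (angle K m `^ p) <= 8 * pi `^ p.
Proof.
apply: (@le_trans _ _ (4 * pi `^ p * 2)); last by lra.
apply: (@le_trans _ _ (\sum_(m < n) 4 * pi `^ p * 2 ^- m)).
  by apply: ler_sum => m _; exact: mult_angle_le.
rewrite -mulr_sumr ler_wpM2l ?mulr_ge0 ?powR_ge0//.
by rewrite -(big_mkord xpredT (fun m => 2 ^- m)) sum_half.
Qed.

(** As [amp * N = 2^(b - n) / L], the powers of [L] cancel and [2^((b - n) p) / (2^n N)] remains.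
    With [N = 2^(2 b)] this is at least [2^n] as soon as [b (p - 2) >= n (p + 2)], which follows
    from [b >= K n] and [Kp]. *)
Lemma le_mult_amp n : n%:R <= (mult n)%:R * ((amp K n * (N n)%:R) `^ p).
Proof.
have L0 := @L_gt0 R K n.
have N0 : (0 : R) < (N n)%:R by rewrite ltr0n expn_gt0.
have Lp0 : 0 < (L n)%:R `^ p :> R by exact: powR_gt0.
have nb := ltnW (lt_bexp K0 n).
have e0 : (0 : R) < 2 ^+ n by rewrite exprn_gt0.
have pw k : (2 : R) ^+ k != 0 by rewrite expf_neq0.
have -> : amp K n * (N n)%:R = 2 ^+ (b n - n) / (L n)%:R :> R.
  apply: (mulIf (lt0r_neq0 L0)); rewrite divfK ?gt_eqF//.
  apply: (mulIf (pw n)); rewrite -exprD subnK//.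
  rewrite /amp /width /level !natrX.
  rewrite (_ : (n + 9 * b n = (8 * b n) + (n + b n))%N); last by lia.
  rewrite (_ : (2 * b n = b n + b n)%N); last by lia.
  rewrite (exprD _ (8 * b n)) (exprD _ n) (exprD _ (b n) (b n)).
  move: (pw (8 * b n)%N) (pw (b n)) (pw n).
  move: (2 ^+ (8 * b n)) (2 ^+ b n) (2 ^+ n) => x y z x0 y0 z0.
  by field; rewrite x0 y0 z0.
have -> : (2 ^+ (b n - n) / (L n)%:R) `^ p = (2 ^+ (b n - n)) `^ p / (L n)%:R `^ p :> R.
  apply: (mulIf (lt0r_neq0 Lp0)); rewrite divfK ?gt_eqF//.
  rewrite -powRM ?divr_ge0 ?exprn_ge0//.
  by rewrite divfK// gt_eqF.
have h1 : ratio n <= (mult n)%:R by rewrite /mult ltW// truncnS_gt.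
have h2 : (2 : R) ^+ (2 * n + 2 * b n) <= (2 ^+ (b n - n)) `^ p.
  rewrite -!powR_mulrn// -powRrM; apply: ler_powR; first by rewrite ler1n.
  rewrite natrB// natrD (natrM _ 2 n) (natrM _ 2 (b n)).
  have h3 : K%:R * n%:R <= (b n)%:R :> R.
    by rewrite -natrM ler_nat /bexp leq_mul2l ltnW ?orbT// ltn_expl.
  have p20 : 0 <= p - 2 by rewrite subr_ge0 ltW.
  have u1 := ler_wpM2r (ler0n R n) Kp; have u2 := ler_wpM2r p20 h3.
  move: (K%:R) (n%:R) (b n)%:R u1 u2 => x y z u1 u2; clear -u1 u2; lra.
apply: (@le_trans _ _ (ratio n * ((2 ^+ (b n - n)) `^ p / (L n)%:R `^ p))); last first.
  by rewrite ler_wpM2r// divr_ge0 ?powR_ge0.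
apply: (@le_trans _ _ (2 ^+ n)).
  by rewrite -natrX ler_nat ltnW// ltn_expl.
have -> : 2 ^+ n = 2 ^+ (2 * n + 2 * b n) / (2 ^+ n * (N n)%:R) :> R.
  rewrite exprD mulnC exprM /width natrX; move: (pw n) (pw (2 * b n)%N).
  move: (2 ^+ n) (2 ^+ (2 * b n)) => x y x0 y0.
  by field; rewrite x0 y0.
rewrite /ratio.
have -> : (L n)%:R `^ p / (2 ^+ n * (N n)%:R) * ((2 ^+ (b n - n)) `^ p / (L n)%:R `^ p) =
  (2 ^+ (b n - n)) `^ p / (2 ^+ n * (N n)%:R).
  move: ((2 ^+ (b n - n)) `^ p) => x; move: Lp0 N0 e0.
  move: ((L n)%:R `^ p) (N n)%:R (2 ^+ n) => y z t y0 z0 t0.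
  by field; rewrite !gt_eqF.
by rewrite ler_wpM2r// invr_ge0 mulr_ge0// ltW.
Qed.

End Multiplicities.

Theorem theorem5p6 (R : realType) (w : R -> R) (hw : besov_cutoff w)
    (p : R) (hp : 2 < p) :
  exists f : torus_fun R, besov_plus w f /\
  exists (H : hilbertType R) (U1 U2 V : unitary H) (A1 A2 : {linear H -> H}),
    [/\ schatten p (U1 \- U2),
        is_fun_unitary f U1 V A1,
        is_fun_unitary f U2 V A2 &
        ~ schatten p (A1 \- A2)].
Proof.
have p0 : 0 <= p by lra.
have p20 : 0 < p - 2 by lra.
(* The scales must be spread further apart as [p] approaches 2, where the gain [2^(b (p - 2))]
   degenerates. *)
pose K := (Num.truncn ((p + 2) / (p - 2))).+1.
have K0 : (0 < K)%N by [].
have Kp : p + 2 <= K%:R * (p - 2) by rewrite -ler_pdivrMr// ltW// truncnS_gt.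
pose f := @testf R K.
exists f; split.
  split; last exact: testf_analytic.
  split; last exact: testf_besov_norm.
  exact/tseries_integrable/coef_cvg.
have bnd := @fourier_testf_le R K K0.
pose r := @mult R p K.
pose W1 : unitary (hl2 R (cell K r)) := opU1 K r.
pose W2 : unitary (hl2 R (cell K r)) := opU2 K r.
pose W : unitary (hl2 R (cell K r)) := opV K r.
have [A1 hA1] := fun_unitary_ex W1 W bnd.
have [A2 hA2] := fun_unitary_ex W2 W bnd.
exists (hl2 R (cell K r)), W1, W2, W, A1, A2; split.
- have r0 n : (0 < r n)%N by [].
  have hM := sum_mult_angle_le hp K0 Kp.
  exact (schatten_diff K0 p0 r0 hM).
- exact: hA1.
- exact: hA2.
- exact: (not_schatten_diff K0 p0 (le_mult_amp hp K0 Kp) hA1 hA2).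
Qed.
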